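(* For any $\epsilon > 0$, there exists $\Delta_0$ such that the following holds. Let $G$ be a multigraph with maximum degree $\Delta > \Delta_0$ and no cycles of length $3$ or $4$, with an assignment of lists $L(v)\subset\mathbb{N}$ to the vertices $v$ such that $|L(v)| \geq (2\sqrt{2}+\epsilon)\sqrt{\Delta/\ln\Delta}$ for each vertex $v$, and let $\tau$ be an edge labelling of $G$ by ordered pairs of colours with conflict degree $D(\tau) \leq \Delta^{\frac{1}{4}\epsilon^2/(\epsilon + 5)^2}$. Then there exists a proper conflict colouring of $G$ from these lists.
   Context: Multigraphs are finite and loopless; parallel edges (i.e. cycles of length 2) are allowed. Cycles of length 3 or 4 pass through 3 or 4 distinct vertices respectively. The degree of a vertex is the number of edges incident to it, counted with multiplicity, and the maximum degree is the largest degree of a vertex. An edge labelling is a map $\tau:E\to\mathbb{N}\times\mathbb{N}$ on the edge set of $G=(V,E)$, where for each edge it is specified which endpoint corresponds to which coordinate of the label. For an edge $e$ with endpoints $u,v$, writing $e=uv$ and $\tau(e)=(c,c')$ means that $c$ is the coordinate corresponding to $u$ and $c'$ the coordinate corresponding to $v$ (so, written as $e=vu$, the same label reads $(c',c)$). Such a label forbids $u$ from receiving $c$ and $v$ from receiving $c'$ simultaneously. A proper conflict colouring of $G$ from lists $L(v)$ is a map $\sigma$ with $\sigma(v)\in L(v)$ for every $v\in V$ such that there is no edge $e=uv$ with $\tau(e)=(\sigma(u),\sigma(v))$. For a colour $c$ and vertices $u,v$, let $d(\tau,c,u,v)$ be the number of edges $e=uv$ such that $\tau(e)=(c,c')$ for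 some colour $c'$ (with $c$ corresponding to $u$). The conflict degree $D(\tau)$ is the maximum of $d(\tau,c,u,v)$ over all colours $c$ and all (ordered) pairs $u,v$. *)

(* Defs.v *)
From mathcomp Require Import all_boot all_order all_algebra.
From mathcomp Require Import all_classical all_reals all_analysis.

Set Implicit Arguments.
Unset Strict Implicit.
Unset Printing Implicit Defensive.

Record multigraph := Multigraph {
  vertex : finType;
  edge : finType;
  ends : edge -> {set vertex};
  card_ends : forall e, #|ends e| = 2 }.

Definition degree (G : multigraph) (v : vertex G) : nat :=
  #|[pred e : edge G | v \in ends e]|.

Definition max_degree (G : multigraph) : nat := \max_(v : vertex G) degree v.

(* Vertices and edges of a cycle are pairwise distinct, so a cycle of length 2
   is a pair of parallel edges.  Indices are cyclic: [ordS] maps k-1 to 0.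
   Only meaningful for k >= 2. *)
Definition has_cycle (G : multigraph) (k : nat) : Prop :=
  exists (x : 'I_k -> vertex G) (e : 'I_k -> edge G),
    [/\ injective x, injective e
      & forall i, ends (e i) = [set x i; x (ordS i)]%SET].

(* [orient e] lists the ends of [e] in the order of the coordinates of
   [label e]: the first coordinate is a colour for [(orient e).1]. *)
Record edge_labelling (G : multigraph) := EdgeLabelling {
  label : edge G -> nat * nat;
  orient : edge G -> vertex G * vertex G;
  orientP : forall e, ends e = [set (orient e).1; (orient e).2]%SET }.

(* [e = uv] and [tau(e) = (c, c')], with [c] at [u] and [c'] at [v]. *)
Definition label_eq (G : multigraph) (tau : edge_labelling G) (e : edge G)
    (u v : vertex G) (c c' : nat) : Prop :=
  (orient tau e = (u, v) /\ label tau e = (c, c')) \/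
  (orient tau e = (v, u) /\ label tau e = (c', c)).

Definition conflict_count (G : multigraph) (tau : edge_labelling G)
    (c : nat) (u v : vertex G) : nat :=
  #|[pred e : edge G | `[< exists c', label_eq tau e u v c c' >]]|.

(* A strict upper bound on the colours occurring in labels; all counts vanish
   beyond it, so that the maximum below ranges over all natural numbers, as
   shown by [conflict_degree_ub] and [conflict_degree_attained]. *)
Definition colour_bound (G : multigraph) (tau : edge_labelling G) : nat :=
  (\max_(e : edge G) maxn (label tau e).1 (label tau e).2).+1.

Definition conflict_degree (G : multigraph) (tau : edge_labelling G) : nat :=
  \max_(c < colour_bound tau) \max_(u : vertex G) \max_(v : vertex G)
    conflict_count tau c u v.

Lemma conflict_count_eq0 (G : multigraph) (tau : edge_labelling G) c u v :
  colour_bound tau <= c -> conflict_count tau c u v = 0.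
Proof.
move=> cB; apply/eq_card0 => e; rewrite !inE; apply/asboolP => -[c' H].
have := @leq_bigmax _ (fun e => maxn (label tau e).1 (label tau e).2) e.
rewrite geq_max => /andP[h1 h2]; move: cB; apply/negP; rewrite -ltnNge ltnS.
by case: H => -[_ le]; rewrite le in h1 h2.
Qed.

Lemma conflict_degree_ub (G : multigraph) (tau : edge_labelling G) c u v :
  conflict_count tau c u v <= conflict_degree tau.
Proof.
have [cB|cB] := ltnP c (colour_bound tau); last by rewrite conflict_count_eq0.
apply: leq_trans (leq_bigmax (Ordinal cB)) => /=.
apply: leq_trans (leq_bigmax u).
exact: leq_bigmax.
Qed.

Lemma conflict_degree_attained (G : multigraph) (tau : edge_labelling G) :
  0 < #|vertex G| ->
  exists c u v, conflict_count tau c u v = conflict_degree tau.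
Proof.
move=> V0; rewrite /conflict_degree.
have [|c ->] := @eq_bigmax _ (fun c : 'I_(colour_bound tau) =>
  \max_(u : vertex G) \max_(v : vertex G) conflict_count tau c u v).
  by rewrite card_ord.
have [//|u ->] := @eq_bigmax _ (fun u : vertex G =>
  \max_(v : vertex G) conflict_count tau c u v).
have [//|v ->] := @eq_bigmax _ (fun v : vertex G => conflict_count tau c u v).
by exists c, u, v.
Qed.

Definition proper_conflict_colouring (G : multigraph) (tau : edge_labelling G)
    (L : vertex G -> set nat) (sigma : vertex G -> nat) : Prop :=
  (forall v, L v (sigma v)) /\
  ~ exists (e : edge G) (u v : vertex G), label_eq tau e u v (sigma u) (sigma v).

(* Main.v *)
(** Keep, at every vertex, half of a palette of [x = (2 sqrt 2 + eps) sqrt (Delta / ln Delta)]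
    colours, discarding those with more than [2 Delta / x] incident conflicts.
    The uniform weights [p v c] on the kept colours then have conflict load
    [sum p u c'] (over the conflicts [(u, c')] of [(v, c)]) at most
    [T = 4 Delta / x ^ 2], which is smaller than [ln sqrt Delta] by a constant
    factor below 1.

    A nibble step activates each [c] at [v] with probability [al * p v c],
    deletes the colours in conflict with an activated neighbour, and divides the
    weight of each surviving colour by its survival probability; vertices whose
    activated colour survives keep it.  Expected weights are unchanged, while
    loads shrink by a factor about [1 - al], the probability of remaining
    uncoloured.  The total weight at a vertex and the loads are concentrated:
    the former by an exponential-moment recursion over the neighbours that stays
    linear in the weights, the latter because, without 3- and 4-cycles, distinct
    neighbours of [v] contribute independently once the choice at [v] is known.
    The local lemma makes all vertices behave at once.  With a bound [P] on the
    weights, [P exp (la T)] does not increase for some [la] close to 1, so that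
    weights stay below a negative power of [Delta] until [T <= 1/16], when one
    last application of the local lemma colours the remaining vertices. *)
Require Import Defs.
From mathcomp Require Import all_boot all_order all_algebra.
From mathcomp Require Import finmap ring lra zify.
From mathcomp Require Import all_classical all_reals all_analysis.

Import Order.TTheory GRing.Theory Num.Theory.
Local Open Scope ring_scope.

Set Implicit Arguments.
Unset Strict Implicit.
Unset Printing Implicit Defensive.

(** * Finite product spaces and the local lemma *)

Section ProductSpace.
Variables (R : realType) (V X : finType) (mu : V -> X -> R).
Hypothesis mu_ge0 : forall v x, 0 <= mu v x.
Hypothesis mu_sum1 : forall v, \sum_x mu v x = 1.

Local Notation conf := {ffun V -> X}.

Definition weight (om : conf) : R := \prod_v mu v (om v).
Definition expect (f : conf -> R) : R := \sum_om weight om * f om.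
Definition update (om : conf) v x : conf :=
  [ffun w => if w == v then x else om w].
Definition depends_on (S : {set V}) (T : Type) (f : conf -> T) :=
  forall om om' : conf, {in S, om =1 om'} -> f om = f om'.

Lemma weight_ge0 om : 0 <= weight om.
Proof. by apply: prodr_ge0 => v _. Qed.

Lemma expect_cst c : expect (fun=> c) = c.
Proof.
rewrite /expect -big_distrl /= (_ : \sum_i _ = 1) ?mul1r //.
by rewrite -(bigA_distr_bigA mu) big1 // => v _; rewrite mu_sum1.
Qed.

Lemma eq_expect f g : f =1 g -> expect f = expect g.
Proof. by move=> fg; apply: eq_bigr => om _; rewrite fg. Qed.

Lemma ler_expect f g : (forall om, f om <= g om) -> expect f <= expect g.
Proof. by move=> fg; apply: ler_sum => om _; rewrite ler_wpM2l ?weight_ge0. Qed.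

Lemma expect_ge0 f : (forall om, 0 <= f om) -> 0 <= expect f.
Proof. by move=> f0; apply: sumr_ge0 => om _; rewrite mulr_ge0 ?weight_ge0. Qed.

Lemma expectZ c f : expect (fun om => c * f om) = c * expect f.
Proof. by rewrite /expect big_distrr /=; apply: eq_bigr => om _; ring. Qed.

Lemma expectD f g : expect (fun om => f om + g om) = expect f + expect g.
Proof. by rewrite /expect -big_split /=; apply: eq_bigr => om _; ring. Qed.

Lemma expectB f g : expect (fun om => f om - g om) = expect f - expect g.
Proof.
by rewrite expectD -[X in _ + X = _](eq_expect (fun=> mulN1r _)) expectZ mulN1r.
Qed.

Lemma expect_sum (I : Type) (r : seq I) (P : pred I) (F : I -> conf -> R) :
  expect (fun om => \sum_(i <- r | P i) F i om) =
  \sum_(i <- r | P i) expect (F i).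
Proof.
by rewrite /expect exchange_big /=; apply: eq_bigr => om _; rewrite mulr_sumr.
Qed.

(* Two independent samples stay independent samples with the same law when they
   exchange their coordinates outside [S]. *)
Lemma expect_indep (S : {set V}) f g :
  depends_on S f -> depends_on (~: S) g ->
  expect (fun om => f om * g om) = expect f * expect g.
Proof.
move=> fS gS; pose mrg (om om' : conf) : conf :=
  [ffun v => if v \in S then om v else om' v].
pose swap (q : conf * conf) := (mrg q.1 q.2, mrg q.2 q.1).
have swapK : involutive swap.
  by move=> [om om']; congr pair; apply/ffunP => v; rewrite !ffunE;
  case: (v \in S).
have -> : expect f * expect g =
    \sum_(q : conf * conf) weight q.1 * weight q.2 * (f q.1 * g q.2).
  rewrite /expect big_distrlr pair_bigA; apply: eq_bigr => q _ /=; ring.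
rewrite (reindex_inj (inv_inj swapK)) /=.
have mrgf om om' : f (mrg om om') = f om.
  by apply: fS => v vS; rewrite ffunE vS.
have mrgg om om' : g (mrg om' om) = g om.
  by apply: gS => v; rewrite ffunE inE; case: ifP.
have mrgw om om' : weight (mrg om om') * weight (mrg om' om) =
    weight om * weight om'.
  rewrite /weight -!big_split; apply: eq_bigr => v _ /=; rewrite !ffunE.
  by case: ifP => // _; rewrite mulrC.
under eq_bigr => q _ do rewrite mrgf mrgg mrgw.
rewrite -(pair_bigA _ (fun om om' => weight om * weight om' * (f om * g om))) /=.
apply: eq_bigr => om _.
rewrite -big_distrl -big_distrr /=.
have -> : \sum_om' weight om' = 1.
  by rewrite -(expect_cst 1); apply: eq_bigr => om' _; rewrite mulr1.
by rewrite mulr1.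
Qed.

(** The indicator of [om v == x] depends on [v] only and [f (update om v x)] on the other
    coordinates only, so [expect_indep] splits their product. *)
Lemma expect_update v f :
  expect f = \sum_x mu v x * expect (fun om => f (update om v x)).
Proof.
have coord x : expect (fun om => (om v == x)%:R) = mu v x.
  transitivity (\prod_w \sum_y mu w y * ((w == v) ==> (y == x))%:R : R).
    rewrite bigA_distr_bigA; apply: eq_bigr => om _; rewrite big_split /=.
    congr (_ * _); rewrite (bigD1 v) //= eqxx /= big1 ?mulr1 // => w wv.
    by rewrite (negbTE wv).
  rewrite (bigD1 v) //= [X in _ * X]big1 ?mulr1; last first.
    move=> w wv; rewrite (negbTE wv) -[RHS](mu_sum1 w).
    by apply: eq_bigr => y _; rewrite mulr1.
  rewrite eqxx (bigD1 x) //= eqxx mulr1 big1 ?addr0 // => y yx.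
  by rewrite (negbTE yx) mulr0.
transitivity (\sum_x expect (fun om => (om v == x)%:R * f (update om v x))).
  rewrite -expect_sum; apply: eq_expect => om.
  rewrite (bigD1 (om v)) //= eqxx mul1r big1 ?addr0; last first.
    by move=> x; rewrite eq_sym => xv; rewrite (negbTE xv) mul0r.
  by congr f; apply/ffunP => w; rewrite ffunE; case: eqP => // ->.
apply: eq_bigr => x _; rewrite (@expect_indep [set v]%SET) ?coord //.
  by move=> om om' /(_ v) ->; rewrite ?inE.
move=> om om' eqv; congr f; apply/ffunP => w; rewrite !ffunE.
by case: eqP => // /eqP wv; apply: eqv; rewrite !inE.
Qed.

Lemma expect_resample v f :
  expect f = expect (fun om => \sum_x mu v x * f (update om v x)).
Proof.
by rewrite expect_sum (expect_update v); apply: eq_bigr => x _; rewrite expectZ.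
Qed.

Lemma expect_coord v (h : X -> R) :
  expect (fun om => h (om v)) = \sum_x mu v x * h x.
Proof.
rewrite (expect_update v); apply: eq_bigr => x _; congr (_ * _).
rewrite -[RHS]expect_cst; apply: eq_expect => om; congr h.
by rewrite ffunE eqxx.
Qed.

Lemma depends_on_prod (I : eqType) (r : seq I) (S : I -> {set V})
    (F : I -> conf -> R) (S0 : {set V}) :
  {in r, forall i, depends_on (S i) (F i)} -> {in r, forall i, S i \subset S0} ->
  depends_on S0 (fun om => \prod_(i <- r) F i om).
Proof.
move=> FS SS om om' eqS0; apply: eq_big_seq => i ir.
by apply: (FS i ir) => v /(fintype.subsetP (SS i ir)); apply: eqS0.
Qed.

Lemma expect_prod (I : eqType) (r : seq I) (S : I -> {set V})
    (F : I -> conf -> R) :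
  uniq r -> {in r, forall i, depends_on (S i) (F i)} ->
  {in r &, forall i j, i != j -> [disjoint S i & S j]} ->
  expect (fun om => \prod_(i <- r) F i om) = \prod_(i <- r) expect (F i).
Proof.
elim: r => [_ _ _|i r IHr /= /andP[ir ur] FS dS].
  by rewrite big_nil -[RHS]expect_cst; apply: eq_expect => om; rewrite big_nil.
rewrite big_cons -IHr //; first last.
- by move=> j k jr kr; apply: dS; rewrite inE ?jr ?kr orbT.
- by move=> j jr; apply: FS; rewrite inE jr orbT.
under eq_expect do rewrite big_cons.
apply: (@expect_indep (S i)); first by apply: FS; rewrite inE eqxx.
apply: (@depends_on_prod _ _ S) => j jr; first by apply: FS; rewrite inE jr orbT.
rewrite finset.subsets_disjoint finset.setCK disjoint_sym dS ?inE ?eqxx ?jr ?orbT //.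
by apply: contraNneq ir => ->.
Qed.

Definition prob (A : pred conf) : R := expect (fun om => (A om)%:R).

Lemma prob_ge0 A : 0 <= prob A.
Proof. by apply: expect_ge0 => om. Qed.

Lemma ler_prob (A B : pred conf) : (forall om, A om -> B om) -> prob A <= prob B.
Proof.
move=> AB; apply: ler_expect => om; rewrite ler_nat.
by case: (A om) (AB om) => //= ->.
Qed.

Lemma prob_has (I : finType) (A : I -> pred conf) :
  prob (fun om => [exists i, A i om]) <= \sum_i prob (A i).
Proof.
rewrite -expect_sum; apply: ler_expect => om.
case: existsP => [[i Ai]|_]; last by apply: sumr_ge0.
by rewrite (bigD1 i) //= Ai lerDl sumr_ge0.
Qed.

Lemma markov_exp (f : conf -> R) (A : pred conf) (a : R) :
  (forall om, A om -> a <= f om) ->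
  prob A <= expR (- a) * expect (fun om => expR (f om)).
Proof.
move=> Af; rewrite -expectZ; apply: ler_expect => om.
rewrite -expRD; case: (boolP (A om)) => [/Af le_af|_]; last exact: expR_ge0.
by rewrite -expR0 ler_expR addrC subr_ge0.
Qed.

(** * The local lemma *)

Section LocalLemma.
Variables (I : finType) (S : I -> {set V}) (A : I -> pred conf).
Hypothesis A_S : forall i, depends_on (S i) (A i).
Hypothesis small :
  forall i, \sum_(j | (j == i) || ~~ [disjoint S j & S i]) prob (A j) <= 4%:R^-1.

Let avoid (J : {set I}) : pred conf := fun om => [forall j in J, ~~ A j om].

Lemma prob_avoid_decomp (J1 J2 : {set I}) :
  prob (avoid J2) - \sum_(j in J1) prob (fun om => A j om && avoid J2 om) <=
  prob (avoid (J1 :|: J2)).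
Proof.
rewrite lerBlDr -expect_sum -expectD; apply: ler_expect => om.
case a2: (avoid J2 om); last by rewrite addr_ge0 ?ler0n // sumr_ge0.
have [a12|/forallPn[j]] := boolP (avoid (J1 :|: J2) om).
  by rewrite lerDl sumr_ge0.
rewrite negb_imply negbK inE => /andP[/orP[jJ1|jJ2] Aj].
  by rewrite add0r (bigD1 j) //= Aj lerDl sumr_ge0.
by move/forallP: a2 => /(_ j); rewrite jJ2 Aj.
Qed.

(** Conditioning on [avoid J] at most doubles the probability of an outside event. The product form
    needs no division while positivity is still being proved. *)
Lemma prob_avoid_lower (n : nat) (J : {set I}) : (#|J| <= n)%N ->
  (0 < prob (avoid J)) /\
  forall i, i \notin J ->
    prob (fun om => A i om && avoid J om) <= 2 * prob (A i) * prob (avoid J).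
Proof.
elim: n J => [|n IHn] J leJ.
  have -> : J = finset.set0 by apply/eqP; rewrite -cards_eq0 -leqn0.
  have av0 om : avoid finset.set0 om by apply/forallP => j; rewrite inE.
  have p0 : prob (avoid finset.set0) = 1.
    by rewrite -[RHS]expect_cst; apply: eq_expect => om; rewrite av0.
  split=> [|i _]; first by rewrite p0.
  rewrite p0 mulr1 (_ : prob _ = prob (A i)); last first.
    by apply: eq_expect => om; rewrite av0 andbT.
  by rewrite ler_peMl ?prob_ge0 // ler1n.
(* By induction the events of [J1] remove at most a fraction 2 / 4 of [avoid J2]. *)
have half (J1 J2 : {set I}) : (J1 :|: J2 = J)%SET -> [disjoint J1 & J2] ->
    (#|J2| <= n)%N -> \sum_(j in J1) prob (A j) <= 4%:R^-1 ->
    0 < prob (avoid J2) /\ prob (avoid J2) <= 2 * prob (avoid J).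
  move=> J12 dJ leJ2 sJ1; have [pos IH] := IHn _ leJ2; split=> //.
  have := prob_avoid_decomp J1 J2; rewrite J12.
  have : \sum_(j in J1) prob (fun om => A j om && avoid J2 om) <=
      \sum_(j in J1) 2 * prob (A j) * prob (avoid J2).
    by apply: ler_sum => j jJ1; apply: IH; rewrite (disjointFr dJ).
  rewrite -big_distrl -big_distrr /=.
  have : 0 <= (4%:R^-1 - \sum_(j in J1) prob (A j)) * prob (avoid J2).
    by rewrite mulr_ge0 ?(ltW pos) // subr_ge0.
  lra.
split.
  have [J0|[j jJ]] := set_0Vmem J.
    by have [|//] := IHn J; rewrite J0 cards0.
  have [||||pos le] := half [set j]%SET (J :\ j)%SET.
  - by rewrite finset.setD1K.
  - by rewrite disjoints1 !inE eqxx.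
  - by rewrite (cardsD1 j) jJ in leJ.
  - rewrite big_set1; apply: le_trans (small j).
    by rewrite (bigD1 j) ?eqxx //= lerDl sumr_ge0 // => k _; apply: prob_ge0.
  by rewrite -(pmulr_rgt0 _ (ltr0n _ 2)) (lt_le_trans pos).
move=> i iJ; pose touch j := ~~ [disjoint S j & S i].
pose J1 := [set j in J | touch j]%SET; pose J2 := [set j in J | ~~ touch j]%SET.
have J12 : (J1 :|: J2 = J)%SET.
  by apply/setP => j; rewrite !inE; case: (j \in J); case: (touch j).
have dJ : [disjoint J1 & J2].
  rewrite -finset.setI_eq0; apply/eqP/setP => j; rewrite !inE.
  by case: (touch j); rewrite ?andbF.
have indep : prob (fun om => A i om && avoid J2 om) = prob (A i) * prob (avoid J2).
  rewrite /prob (_ : (fun om => _%:R) =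
      fun om => (A i om)%:R * (avoid J2 om)%:R); last first.
    by apply/funext => om; case: (A i om); rewrite ?mul1r ?mul0r.
  apply: (@expect_indep (S i)).
    by move=> om om' eqS; rewrite (A_S eqS).
  move=> om om' eqS; congr (nat_of_bool _)%:R; apply: eq_forallb => j.
  case: (boolP (j \in J2)) => //= jJ2; congr (~~ _); apply: A_S => v vSj.
  apply: eqS; rewrite inE; move: jJ2; rewrite inE negbK => /andP[_].
  by move=> /disjointFr -> //.
(* If no event of [J] touches [i], then [J2] is [J] itself, not smaller, and independence alone
   concludes. *)
have [J10|[j jJ1]] := set_0Vmem J1.
  move: indep; rewrite -J12 J10 finset.set0U => ->.
  by rewrite -mulrA ler_peMl ?mulr_ge0 ?prob_ge0 // ler1n.
have [//|//|||pos le] := half J1 J2.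
- rewrite -ltnS; apply: leq_trans leJ; rewrite -J12 cardsU.
  rewrite (_ : (_ :&: _)%SET = finset.set0) ?cards0 ?subn0; last first.
    by apply/eqP; rewrite finset.setI_eq0.
  by rewrite -[X in (X < _)%N]add0n ltn_add2r card_gt0; apply/set0Pn; exists j.
- apply: le_trans (small i); rewrite big_mkcond [leRHS]big_mkcond /=.
  apply: ler_sum => k _; rewrite inE /touch.
  case: [disjoint _ & _]; case: (k \in J); rewrite ?orbT ?orbF ?prob_ge0 //=;
  by case: ifP; rewrite ?prob_ge0.
apply: le_trans (_ : prob (fun om => A i om && avoid J2 om) <= _).
  apply: ler_prob => om /andP[-> /forallP av] /=; apply/forallP => k.
  by have := av k; rewrite !inE; case: (k \in J) => //= ->; rewrite implybT.
by rewrite indep -mulrA mulrCA ler_wpM2l ?prob_ge0.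
Qed.

(** Positive weight is recorded because it makes every colour picked by [om] one of positive
    weight. *)
Lemma local_lemma : exists om, 0 < weight om /\ forall i, ~~ A i om.
Proof.
have [pos _] := prob_avoid_lower (leqnn #|[set: I]%SET|).
suff /existsP[om /andP[w0 /forallP av]] :
    [exists om, (0 < weight om) && avoid [set: I]%SET om].
  by exists om; split=> // i; have := av i; rewrite inE.
apply: contraTT pos => /existsPn no; rewrite -leNgt /prob /expect big1 // => om _.
have := no om; rewrite negb_and lt_def weight_ge0 andbT negbK.
by case/orP => [/eqP->|/negbTE->]; rewrite ?mul0r ?mulr0.
Qed.

End LocalLemma.

End ProductSpace.

(** * The nibble *)

Section Inequalities.
Variable R : realType.

(** [expR y] is at most 1 / (1 - y), and (1 - y) (1 + y + 2 y^2) = 1 + y^2 (1 - 2 y) is at least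
    1. *)
Lemma expR_le_quadratic (y : R) :
  0 <= y -> y <= 2^-1 -> expR y <= 1 + y + 2 * y ^+ 2.
Proof.
move=> y0 y2; have h : 1 - y <= expR (- y) by have := expR_ge1Dx (- y).
have e0 := expR_gt0 y.
have : expR (- y) * expR y = 1 by rewrite -expRD addNr expR0.
nra.
Qed.

(** Lets the exponential moment of a variable with values in [0, B] be bounded through its mean
    alone. *)
Lemma expR_mul_le_linear (s B y : R) : 0 <= s -> s * B <= 2^-1 ->
  0 <= y -> y <= B -> expR (s * y) <= 1 + (1 + 2 * (s * B)) * (s * y).
Proof.
move=> s0 sB y0 yB.
have sy0 : 0 <= s * y by rewrite mulr_ge0.
have sysB : s * y <= s * B by rewrite ler_wpM2l.
have := expR_le_quadratic sy0 (le_trans sysB sB); nra.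
Qed.

Lemma expRN_le_1B (x e : R) :
  0 <= x -> x <= 2^-1 -> 2 * x <= e -> expR (- ((1 + e) * x)) <= 1 - x.
Proof.
move=> x0 x2 xe; set y := (1 + e) * x.
have y0 : 0 <= y by rewrite /y; nra.
have h : 1 + y <= expR y := expR_ge1Dx y.
have ee : expR (- y) * expR y = 1 by rewrite -expRD addNr expR0.
have e0 := expR_gt0 (- y).
have xe' : (1 + e) * x <= e by nra.
have : 1 <= (1 - x) * (1 + y) by rewrite /y; nra.
nra.
Qed.

Lemma prod_1B_ge (I : Type) (r : seq I) (Q : pred I) (x : I -> R) :
  (forall i, Q i -> 0 <= x i <= 1) ->
  1 - \sum_(i <- r | Q i) x i <= \prod_(i <- r | Q i) (1 - x i).
Proof.
move=> x01; elim: r => [|i r IHr]; first by rewrite !big_nil subr0.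
rewrite !big_cons; case: ifP => // Qi; have /andP[x0 x1] := x01 i Qi.
have S0 : 0 <= \sum_(j <- r | Q j) x j.
  by apply: sumr_ge0 => j /x01/andP[].
by nra.
Qed.

End Inequalities.

Lemma expect_prod_coord (R : realType) (V X : finType) (mu : V -> X -> R)
    (h : V -> X -> R) :
  expect mu (fun om => \prod_v h v (om v)) = \prod_v \sum_x mu v x * h v x.
Proof.
by rewrite bigA_distr_bigA; apply: eq_bigr => om _; rewrite big_split.
Qed.

(** * Weighted conflict structures *)

Section ConflictStructure.
Variables (R : realType) (V C : finType).
Variables (adj : rel V) (K : V -> C -> V -> C -> bool).

Definition colour_load (p : V -> C -> R) v c : R :=
  \sum_u \sum_x (K v c u x)%:R * p u x.

Definition solvable (U : pred V) (p : V -> C -> R) :=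
  exists sigma : V -> C, (forall v, U v -> 0 < p v (sigma v)) /\
    forall u v, U u -> U v -> ~~ K v (sigma v) u (sigma u).

(** Vertices outside [U] are already coloured; their weight is zero, so they drop out of all
    loads. *)
Record state (P T : R) (U : pred V) (p : V -> C -> R) : Prop := State {
  p_ge0 : forall v c, 0 <= p v c;
  p_sum : forall v, \sum_c p v c = (U v)%:R;
  p_le : forall v c, p v c <= P;
  p_load : forall v c, colour_load p v c <= T }.

Hypothesis adj_sym : symmetric adj.
Hypothesis adj_irr : irreflexive adj.
Hypothesis K_sym : forall v c u x, K v c u x = K u x v c.
Hypothesis K_adj : forall v c u x, K v c u x -> adj v u.
Variable D : R.
Hypothesis no3 : forall x y z, adj x y -> adj y z -> adj z x -> False.
Hypothesis no4 : forall a b c d, adj a b -> adj b c -> adj c d -> adj d a ->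
  a != c -> b != d -> False.
Hypothesis K_D : forall v c u, \sum_x (K v c u x)%:R <= D.

Variable nd : nat.
Definition nbhd v : {set V} := [set w | (w == v) || adj v w]%SET.
Hypothesis deg : forall v, (#|nbhd v| <= nd)%N.

(** * One nibble step: activation, survival and reweighting *)

Section Step.
Variables (P T : R) (U : pred V) (p : V -> C -> R).
Hypothesis st : state P T U p.
Variables (al de B eta : R).
Hypothesis al0 : 0 < al.
Hypothesis al1 : al <= 2^-1.
Hypothesis de0 : 0 < de.
Hypothesis de1 : de <= 10%:R^-1.
Hypothesis alT : al * T <= de.
Hypothesis DP : D * P <= de / 2.
Hypothesis B0 : 0 < B.
Hypothesis DPB : 2 * (D * P) <= B.
Hypothesis eta0 : 0 < eta.
Hypothesis eta1 : eta <= 2^-1.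

(** [None] means no activation; it is certain outside [U]. *)
Definition activation v (o : option C) : R :=
  if o is Some c then al * p v c else 1 - al * (U v)%:R.

Local Notation mu := activation.
Local Notation conf := {ffun V -> option C}.

Lemma activation_ge0 v o : 0 <= mu v o.
Proof.
case: o => [c|] /=; first by rewrite mulr_ge0 ?(p_ge0 st) // ltW.
by have := al1; case: (U v); rewrite ?mulr1 ?mulr0; lra.
Qed.

Lemma big_option (F : option C -> R) : \sum_o F o = F None + \sum_c F (Some c).
Proof.
rewrite (bigD1 None) //=; congr (_ + _).
rewrite (reindex_omap Some id) /=; last by case.
by apply: eq_bigl => c; rewrite eqxx.
Qed.

Lemma activation_sum v : \sum_o mu v o = 1.
Proof. by rewrite big_option /= -mulr_sumr (p_sum st) subrK. Qed.

Definition kills v c w (o : option C) := if o is Some x then K v c w x else false.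

Definition hit v c w : R := \sum_o mu w o * (kills v c w o)%:R.

Definition survives (om : conf) v c := [forall w, ~~ kills v c w (om w)].

(** The survival probability of [c] at [v], a product since vertices activate independently. *)
Definition keep v c : R := \prod_w (1 - hit v c w).

Definition coloured (om : conf) v :=
  if om v is Some x then survives om v x else false.

Definition reweighted om v c : R := p v c / keep v c * (survives om v c)%:R.

Definition total om v : R := \sum_c reweighted om v c.

Definition load_from om v c u : R :=
  (~~ coloured om u)%:R * \sum_x (K v c u x)%:R * reweighted om u x.

Definition new_load om v c : R := \sum_u load_from om v c u.

Lemma hitE v c w : hit v c w = al * \sum_x (K v c w x)%:R * p w x.
Proof.
rewrite /hit big_option /= mulr0 add0r mulr_sumr; apply: eq_bigr => x _.
by rewrite -mulrA [_ * p _ _]mulrC.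
Qed.

Lemma hit_ge0 v c w : 0 <= hit v c w.
Proof. by apply: sumr_ge0 => o _; rewrite mulr_ge0 ?activation_ge0. Qed.

Lemma hit_sum v c : \sum_w hit v c w <= de.
Proof.
under eq_bigr do rewrite hitE; rewrite -mulr_sumr.
apply: le_trans alT; by rewrite ler_wpM2l ?(p_load st) // ltW.
Qed.

Lemma hit_le_de v c w : hit v c w <= de.
Proof.
apply: le_trans (hit_sum v c); rewrite (bigD1 w) //= lerDl.
by apply: sumr_ge0 => u _; apply: hit_ge0.
Qed.

Lemma P_ge0 (v : V) (c : C) : 0 <= P.
Proof. exact: le_trans (p_ge0 st v c) (p_le st v c). Qed.

Lemma K_p_sum v c w : \sum_x (K v c w x)%:R * p w x <= D * P.
Proof.
apply: le_trans (_ : \sum_x (K v c w x)%:R * P <= _).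
  by apply: ler_sum => x _; rewrite ler_wpM2l ?(p_le st).
by rewrite -mulr_suml ler_wpM2r ?K_D // (P_ge0 v c).
Qed.

Lemma hit_le_DP v c w : hit v c w <= al * (D * P).
Proof. by rewrite hitE ler_wpM2l ?K_p_sum // ltW. Qed.

Lemma hit0 v c w : ~~ adj v w -> hit v c w = 0.
Proof.
move=> nadj; rewrite hitE big1 ?mulr0 // => x _.
by rewrite (contraNF (@K_adj v c w x) nadj) mul0r.
Qed.

Lemma keep_gt0 v c : 0 < keep v c.
Proof.
apply: prodr_gt0 => w _; rewrite subr_gt0; apply: le_lt_trans (hit_le_de v c w) _.
move: de1; lra.
Qed.

Lemma keep_ge_half v c : 2^-1 <= keep v c.
Proof.
apply: le_trans (prod_1B_ge _ _); last first.
  move=> w _; rewrite hit_ge0 (le_trans (hit_le_de v c w)) //.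
  by move: de1; lra.
have := hit_sum v c; move: de1; lra.
Qed.

(** Each [hit] is at most [al * (D * P) <= de / 4], so [expRN_le_1B] applies factor by factor with
    slack [de]. *)
Lemma keep_ge_exp v c : expR (- ((1 + de) * (al * T))) <= keep v c.
Proof.
apply: le_trans (_ : expR (\sum_w - ((1 + de) * hit v c w)) <= _); last first.
  rewrite expR_sum; apply: ler_prod => w _; rewrite expR_ge0 expRN_le_1B //.
  - exact: hit_ge0.
  - by apply: le_trans (hit_le_de v c w) _; move: de1; lra.
  - have := hit_le_DP v c w; move: DP al0 al1 de0; nra.
rewrite ler_expR sumrN lerN2 -mulr_sumr ler_wpM2l //; first by move: de0; lra.
under eq_bigr do rewrite hitE; rewrite -mulr_sumr.
by rewrite ler_wpM2l ?(p_load st) // ltW.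
Qed.

Lemma p_keep_le v c : p v c / keep v c <= 2 * P.
Proof.
rewrite ler_pdivrMr ?keep_gt0 //; have := keep_ge_half v c.
have := P_ge0 v c; have := p_le st v c; nra.
Qed.

Lemma p_keep_ge0 v c : 0 <= p v c / keep v c.
Proof. by rewrite divr_ge0 ?(p_ge0 st) // ltW ?keep_gt0. Qed.

(** [B] limits the influence of a single vertex in both tail estimates. *)
Lemma K_p_keep_sum v c w : \sum_x (K v c w x)%:R * (p w x / keep w x) <= B.
Proof.
apply: le_trans (_ : \sum_x (K v c w x)%:R * (2 * P) <= _).
  by apply: ler_sum => x _; rewrite ler_wpM2l ?p_keep_le.
rewrite -mulr_suml; apply: le_trans DPB; rewrite mulrCA.
by rewrite ler_wpM2l // ler_wpM2r ?K_D // (P_ge0 v c).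
Qed.

Lemma survivesE om v c :
  (survives om v c)%:R = \prod_w (~~ kills v c w (om w))%:R :> R.
Proof.
rewrite /survives; case: forallP => [al_w|/forallP/forallPn[w kw]].
  by rewrite big1 // => w _; rewrite al_w.
by rewrite (bigD1 w) //= (negbTE kw) mul0r.
Qed.

Lemma expect_not_kills v c w :
  \sum_o mu w o * (~~ kills v c w o)%:R = 1 - hit v c w.
Proof.
rewrite -[X in X - _](activation_sum w) -sumrB; apply: eq_bigr => o _.
by case: (kills v c w o); rewrite /= ?mulr0n ?mulr1n ?mulr0 ?mulr1 ?subrr ?subr0.
Qed.

(** * Lower tail of the total weight at a vertex *)

Section LowerTail.
Variables (v : V) (s : R).
Hypothesis s0 : 0 <= s.
Hypothesis sB : s * B <= 2^-1.

Let b := 1 + 2 * (s * B).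

(* The exponent on the right is again linear in [q], so that the bound can be
   iterated over the neighbours of [v]. *)
Lemma lower_mgf_vertex w (q : C -> R) : (forall c, 0 <= q c) ->
  (forall x, \sum_c q c * (K v c w x)%:R <= B) ->
  \sum_o mu w o * expR (- (s * \sum_c q c * (~~ kills v c w o)%:R)) <=
  expR (- (s * \sum_c q c * (1 - b * hit v c w))).
Proof.
move=> q0 qB; pose y o := \sum_c q c * (kills v c w o)%:R.
have yB o : 0 <= y o <= B.
  rewrite sumr_ge0 => [|c _]; last by rewrite mulr_ge0.
  case: o => [x|]; first exact: qB.
  have -> : y None = 0 by rewrite /y big1 // => c _; rewrite mulr0.
  exact: ltW.
have eqy o : \sum_c q c * (~~ kills v c w o)%:R = \sum_c q c - y o.
  rewrite -sumrB; apply: eq_bigr => c _.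
  by case: (kills v c w o); rewrite /= ?mulr0n ?mulr1n ?mulr0 ?mulr1 ?subrr ?subr0.
have Ey : \sum_o mu w o * y o = \sum_c q c * hit v c w.
  under eq_bigr do rewrite mulr_sumr; rewrite exchange_big /=.
  by apply: eq_bigr => c _; rewrite mulr_sumr; apply: eq_bigr => o _; ring.
apply: le_trans (_ : \sum_o mu w o *
    (expR (- (s * \sum_c q c)) * (1 + b * (s * y o))) <= _).
  apply: ler_sum => o _; rewrite ler_wpM2l ?activation_ge0 // eqy.
  rewrite mulrBr opprB addrC expRD ler_wpM2l ?expR_ge0 //.
  by have /andP[? ?] := yB o; apply: expR_mul_le_linear.
have -> : \sum_o mu w o * (expR (- (s * \sum_c q c)) * (1 + b * (s * y o))) =
    expR (- (s * \sum_c q c)) * (1 + b * (s * \sum_c q c * hit v c w)).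
  set e := expR _.
  rewrite (eq_bigr (fun o => e * mu w o + e * b * s * (mu w o * y o))); last first.
    by move=> o _; ring.
  by rewrite big_split -!mulr_sumr activation_sum Ey /=; ring.
apply: le_trans (_ : expR (- (s * \sum_c q c)) *
    expR (b * (s * \sum_c q c * hit v c w)) <= _).
  by rewrite ler_wpM2l ?expR_ge0 // expR_ge1Dx.
rewrite -expRD ler_expR le_eqVlt; apply/orP; left; apply/eqP.
rewrite !mulr_sumr -!sumrN -big_split /=.
by apply: eq_bigr => c _; ring.
Qed.

(** Resampling [w] with the others fixed replaces its indicator by [1 - b * hit v c w]. This factor
    lies in [0, 1], so it can be absorbed into [q] without harming the hypotheses. *)
Lemma lower_mgf (r : seq V) (q : C -> R) : uniq r -> (forall c, 0 <= q c) ->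
  (forall w x, \sum_c q c * (K v c w x)%:R <= B) ->
  expect mu (fun om => expR (- (s *
    \sum_c q c * \prod_(w <- r) (~~ kills v c w (om w))%:R))) <=
  expR (- (s * \sum_c q c * \prod_(w <- r) (1 - b * hit v c w))).
Proof.
have bhit c w : 0 <= 1 - b * hit v c w <= 1.
  have h0 := hit_ge0 v c w; have h1 := hit_le_de v c w.
  have sB0 : 0 <= s * B by rewrite mulr_ge0 // ltW.
  by move: s0 sB B0 de0 de1; rewrite /b => *; apply/andP; split; nra.
elim: r q => [q _ _ _|w r IHr q /= /andP[wr ur] q0 qB].
  rewrite -[leRHS](expect_cst activation_sum); apply: ler_expect => [|om].
    exact: activation_ge0.
  by rewrite ler_expR lerN2 ler_wpM2l // ler_sum // => c _; rewrite !big_nil.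
rewrite (expect_resample activation_sum w).
pose q' c := q c * (1 - b * hit v c w).
apply: le_trans (_ : expect mu (fun om => expR (- (s *
    \sum_c q' c * \prod_(w <- r) (~~ kills v c w (om w))%:R))) <= _).
  apply: ler_expect => [|om]; first exact: activation_ge0.
  pose Z c : R := \prod_(w <- r) (~~ kills v c w (om w))%:R.
  have Z01 c : 0 <= Z c <= 1.
    rewrite /Z; elim: (r) => [|a r' /andP[z0 z1]]; first by rewrite big_nil lexx ler01.
    by rewrite big_cons; case: kills; rewrite ?mul0r ?mul1r ?lexx ?ler01 ?z0 ?z1.
  have qZ0 c : 0 <= q c * Z c by have /andP[? _] := Z01 c; rewrite mulr_ge0.
  have qZB x : \sum_c q c * Z c * (K v c w x)%:R <= B.
    apply: le_trans (qB w x); apply: ler_sum => c _.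
    by have /andP[? ?] := Z01 c; rewrite ler_wpM2r // ler_piMr.
  have := lower_mgf_vertex qZ0 qZB.
  rewrite [X in _ <= expR (- (s * X)) -> _](_ : _ = \sum_c q' c * Z c); last first.
    by apply: eq_bigr => c _; rewrite /q'; ring.
  apply: le_trans.
  apply: ler_sum => o _; rewrite ler_wpM2l ?activation_ge0 // ler_expR lerN2.
  rewrite ler_wpM2l // ler_sum // => c _; rewrite big_cons ffunE eqxx.
  rewrite -mulrA ler_wpM2l // mulrC ler_wpM2l // /Z le_eqVlt; apply/orP; left.
  apply/eqP; apply: eq_big_seq => u ur'; rewrite ffunE ifN //.
  by apply: contraNneq wr => <-.
apply: le_trans (IHr q' ur _ _) _.
- by move=> c; have /andP[? _] := bhit c w; rewrite mulr_ge0.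
- move=> u x; apply: le_trans (qB u x); apply: ler_sum => c _.
  have /andP[? ?] := bhit c w; rewrite /q' ler_wpM2r //.
  by rewrite ler_piMr.
rewrite ler_expR lerN2 ler_wpM2l // ler_sum // => c _.
by rewrite big_cons /q' mulrA.
Qed.

End LowerTail.

Lemma prob_total_small v : U v ->
  prob mu (fun om => total om v < 1 - eta) <= expR (- (eta ^+ 2 / (16%:R * B))).
Proof.
(* With [s * B = eta / 8] the bound on the mean loses at most [eta / 2]; the other half of the
   deviation gives the exponent [- (s * (eta / 2))]. *)
move=> Uv; pose s := eta / (8%:R * B); have s0 : 0 <= s by rewrite divr_ge0 ?mulr_ge0 // ltW.
have sBe : s * B = eta / 8%:R by rewrite /s; field; rewrite gt_eqF.
have sB : s * B <= 2^-1 by rewrite sBe; move: eta1; lra.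
apply: le_trans (_ : expR (s * (1 - eta)) *
   expect mu (fun om => expR (- (s * total om v))) <= _).
  rewrite -[X in expR X * _]opprK; apply: markov_exp.
    exact: activation_ge0.
  by move=> om /ltW le1; rewrite lerN2 ler_wpM2l.
have -> : (fun om => expR (- (s * total om v))) = (fun om => expR (- (s *
    \sum_c p v c / keep v c * \prod_(w <- index_enum V) (~~ kills v c w (om w))%:R))).
  apply/funext => om; congr (expR (- (s * _))); apply: eq_bigr => c _.
  by rewrite /reweighted survivesE.
apply: le_trans (_ : expR (s * (1 - eta)) * expR (- (s * \sum_c p v c / keep v c
   * \prod_w (1 - (1 + 2 * (s * B)) * hit v c w))) <= _).
  rewrite ler_wpM2l ?expR_ge0 // lower_mgf //.
  - exact: index_enum_uniq.
  - by move=> c; apply: p_keep_ge0.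
  - move=> w x; apply: le_trans (K_p_keep_sum w x v); apply: ler_sum => c _.
    by rewrite mulrC K_sym.
rewrite -expRD ler_expR.
(* For h = [hit v c w], (1 - 4 s B h) (1 - h) <= 1 - (1 + 2 s B) h because h <= 1/2; dividing by
   [keep] thus leaves only the loss 4 s B [de]. *)
have : 1 - 4%:R * (s * B) * de <= \sum_c p v c / keep v c *
    \prod_w (1 - (1 + 2 * (s * B)) * hit v c w).
  rewrite -[leLHS]mul1r -[X in X * _](_ : \sum_c p v c = 1); last first.
    by rewrite (p_sum st) Uv.
  rewrite mulr_suml; apply: ler_sum => c _.
  rewrite -[leRHS]mulrA ler_wpM2l ?(p_ge0 st) // [leRHS]mulrC ler_pdivlMr ?keep_gt0 //.
  have sB0 : 0 <= s * B by rewrite mulr_ge0 // ltW.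
  apply: le_trans (_ : \prod_w (1 - 4%:R * (s * B) * hit v c w) * keep v c <= _).
    rewrite ler_wpM2r ?(ltW (keep_gt0 _ _)) //; apply: le_trans (prod_1B_ge _ _).
      by rewrite lerD2l lerN2 -mulr_sumr ler_wpM2l ?hit_sum // mulr_ge0.
    move=> w _; have := hit_ge0 v c w; have := hit_le_de v c w => h1 h0.
    apply/andP; split; first by rewrite mulr_ge0 // mulr_ge0.
    have : s * B * hit v c w <= 2^-1 * hit v c w by rewrite ler_wpM2r.
    by move: de1; nra.
  rewrite /keep -big_split; apply: ler_prod => w _ /=.
  have := hit_ge0 v c w; have := hit_le_de v c w => h1 h0.
  have sh0 : 0 <= s * B * hit v c w by rewrite mulr_ge0.
  have sh1 : s * B * hit v c w <= 2^-1 * hit v c w by rewrite ler_wpM2r.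
  by move: de1 => *; apply/andP; split; nra.
set Sg := \sum_c _ => leS.
have e2 : eta ^+ 2 / (16%:R * B) = s * (eta / 2).
  by rewrite /s; field; rewrite gt_eqF.
have : 0 <= s * (Sg - (1 - eta / 2)).
  by rewrite mulr_ge0 //; move: leS; rewrite sBe; move: de1 de0 eta0; nra.
rewrite e2; lra.
Qed.

(** * Locality of survival and of loads *)

Lemma kills_adj v c w o : kills v c w o -> adj v w.
Proof. by case: o => //= x /K_adj. Qed.

Lemma survives_nbhd v c : depends_on (nbhd v) (fun om => survives om v c).
Proof.
move=> om om' eqo; apply: eq_forallb => w.
case: (boolP (adj v w)) => [vw|nvw]; first by rewrite eqo // inE vw orbT.
by rewrite !(contraNF (@kills_adj v c w _) nvw).
Qed.

Lemma reweighted_nbhd v c : depends_on (nbhd v) (fun om => reweighted om v c).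
Proof. by move=> om om' eqo; rewrite /reweighted (survives_nbhd _ eqo). Qed.

Lemma total_nbhd v : depends_on (nbhd v) (fun om => total om v).
Proof.
by move=> om om' eqo; apply: eq_bigr => c _; rewrite (reweighted_nbhd _ eqo).
Qed.

Lemma load_from_nbhd v c u : depends_on (nbhd u) (fun om => load_from om v c u).
Proof.
move=> om om' eqo; rewrite /load_from /coloured eqo ?inE ?eqxx //.
congr (_ * _); last first.
  by apply: eq_bigr => x _; rewrite (reweighted_nbhd _ eqo).
by case: (om' u) => // x; rewrite (survives_nbhd _ eqo).
Qed.

Lemma load_from_nadj om v c u : ~~ adj v u -> load_from om v c u = 0.
Proof.
move=> nvu; rewrite /load_from big1 ?mulr0 // => x _.
by rewrite (contraNF (@K_adj v c u x) nvu) mul0r.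
Qed.

Lemma reweighted_ge0 om v c : 0 <= reweighted om v c.
Proof. by rewrite mulr_ge0 ?p_keep_ge0. Qed.

Lemma reweighted_le om v c : reweighted om v c <= p v c / keep v c.
Proof. by rewrite ler_piMr ?p_keep_ge0 // lern1 leq_b1. Qed.

Lemma load_from_ge0 om v c u : 0 <= load_from om v c u.
Proof.
by rewrite mulr_ge0 // sumr_ge0 // => x _; rewrite mulr_ge0 ?reweighted_ge0.
Qed.

Lemma load_from_le om v c u : load_from om v c u <= B.
Proof.
apply: le_trans (K_p_keep_sum v c u).
apply: le_trans (_ : \sum_x (K v c u x)%:R * reweighted om u x <= _).
  rewrite ler_piMl ?sumr_ge0 // => [x _|]; first by rewrite mulr_ge0 ?reweighted_ge0.
  by rewrite lern1 leq_b1.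
by apply: ler_sum => x _; rewrite ler_wpM2l ?reweighted_le.
Qed.

(** Bounds the factor by which expected loads shrink; [4 * de] pays for killed activations and for
    revealing the choice of one neighbour. *)
Definition decay : R := 1 - al * (1 - 4%:R * de).

(** * Survival at [u] once the choice [g] of its neighbour [v] is revealed *)

Section Revealed.
Variables (v u : V) (g : option C).
Hypothesis vu : adj v u.
Hypothesis Uu : U u.

Let om_g (om : conf) := update om v g.
Let nk x w o : R := (~~ kills u x w o)%:R.
(** [Z] and [Y] ignore the coordinate [v]: in [Z] no other vertex kills [c] at [u]; in [Y] moreover
    [u] activates [x], which no other vertex kills. *)
Let Z c (om : conf) : R := \prod_(w | w != v) nk c w (om w).
Let Y c x (om : conf) : R :=
  (om u == Some x)%:R * \prod_(w | w != v) (nk c w (om w) * nk x w (om w)).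

Let uv : u != v.
Proof. by apply: contraTneq vu => ->; rewrite adj_irr. Qed.

Lemma survives_revealed c om :
  (survives (om_g om) u c)%:R = nk c v g * Z c om.
Proof.
rewrite survivesE (bigD1 v) //= ffunE eqxx; congr (_ * _).
by apply: eq_bigr => w wv; rewrite ffunE (negbTE wv).
Qed.

Lemma coloured_revealed c om :
  \sum_x nk x v g * Y c x om = Z c om * (coloured (om_g om) u)%:R.
Proof.
rewrite /Y /coloured ffunE (negbTE uv); case omu: (om u) => [y|]; last first.
  by rewrite mulr0 big1 // => x _; rewrite mul0r mulr0.
rewrite (bigD1 y) //= eqxx mul1r [X in _ + X]big1 ?addr0 => [|x xy]; last first.
  rewrite (_ : (Some y == Some x) = (y == x)) //.
  by rewrite eq_sym (negbTE xy) mul0r mulr0.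
by rewrite survives_revealed big_split mulrCA /Z.
Qed.

Lemma uncoloured_revealed c om :
  (survives (om_g om) u c && ~~ coloured (om_g om) u)%:R <=
  Z c om - \sum_x nk x v g * Y c x om.
Proof.
have Z0 : 0 <= Z c om by apply: prodr_ge0.
have nk1 : nk c v g <= 1 by rewrite lern1 leq_b1.
rewrite coloured_revealed -mulnb natrM survives_revealed.
by case: (coloured _ u); rewrite /= ?mulr0 ?mulr1 ?subrr ?subr0 // ler_piMl.
Qed.

Let kp c : R := \prod_(w | w != v) (1 - hit u c w).

Lemma expect_Z c : expect mu (Z c) = kp c.
Proof.
rewrite /kp big_mkcond; transitivity (expect mu (fun om =>
  \prod_w (if w != v then nk c w (om w) else 1))).
  by apply: eq_expect => om; rewrite /Z big_mkcond.
rewrite (expect_prod_coord mu (fun w o => if w != v then nk c w o else 1)).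
apply: eq_bigr => w _; case: (w != v); first exact: expect_not_kills.
by rewrite -[RHS](activation_sum w); apply: eq_bigr => o _; rewrite mulr1.
Qed.

Lemma hit_self c : hit u c u = 0.
Proof. by apply: hit0; rewrite adj_irr. Qed.

(** Survival of [c] and of [x] need not be independent, but at each vertex the union bound 1 - hc -
    hx on the two hit probabilities is at least (1 - hc) (1 - 2 hx), which factors. *)
Lemma expect_Y_ge c x :
  al * p u x * (kp c * (1 - 2 * de)) <= expect mu (Y c x).
Proof.
pose h w o : R := (if w == u then (o == Some x)%:R else 1) *
  (if w != v then nk c w o * nk x w o else 1).
have -> : expect mu (Y c x) = expect mu (fun om => \prod_w h w (om w)).
  apply: eq_expect => om; rewrite big_split /= /Y; congr (_ * _); last by rewrite big_mkcond.
  by rewrite -big_mkcond big_pred1_eq.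
rewrite (expect_prod_coord mu h) (bigD1 u) //=.
have -> : \sum_o mu u o * h u o = al * p u x.
  rewrite (bigD1 (Some x)) //= big1 ?addr0 => [|o ox]; last first.
    by rewrite /h eqxx (negbTE ox) mul0r mulr0.
  have nk1 y o : nk y u o = 1.
    by rewrite /nk (contraFF (@kills_adj u y u o) (adj_irr u)).
  by rewrite /h !eqxx uv !nk1 !mulr1.
rewrite (ler_wpM2l (mulr_ge0 (ltW al0) (p_ge0 st u x))) //.
pose G w := (1 - hit u c w) * (1 - 2 * hit u x w).
have hit01 y w : 0 <= hit u y w <= 10%:R^-1.
  by rewrite hit_ge0 (le_trans (hit_le_de _ _ _)).
apply: le_trans (_ : \prod_(w | w != v) G w <= _).
  rewrite big_split /= ler_wpM2l //.
    by apply: prodr_ge0 => w _; have := hit01 c w; lra.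
  apply: le_trans (prod_1B_ge _ _) => [|w _]; last by have := hit01 x w; lra.
  rewrite lerD2l lerN2 -mulr_sumr ler_wpM2l //.
  apply: le_trans (hit_sum u x); rewrite [leRHS](bigID (fun w => w != v)) /= lerDl.
  by apply: sumr_ge0 => w _; apply: hit_ge0.
rewrite big_mkcond (bigD1 u) //= uv {1}/G !hit_self mulr0 !subr0 mulr1 mul1r.
apply: ler_prod => w wu; rewrite /h (negbTE wu).
have := hit01 c w; have := hit01 x w => hx hc.
case: (boolP (w != v)) => wv; last first.
  rewrite ler01 /=; rewrite -[leLHS](activation_sum w) ler_sum // => o _.
  by rewrite !mulr1.
apply/andP; split; first by rewrite mulr_ge0 //; lra.
apply: le_trans (_ : 1 - hit u c w - hit u x w <= _); first by rewrite /G; nra.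
rewrite -[X in X - _ - _](activation_sum w) -!sumrB; apply: ler_sum => o _.
rewrite mul1r -[X in X - _ - _]mulr1 -!mulrBr ler_wpM2l ?activation_ge0 // /nk.
by case: (kills u c w o); case: (kills u x w o) => /=; lra.
Qed.

Lemma expect_uncoloured c :
  expect mu (fun om => (survives (om_g om) u c && ~~ coloured (om_g om) u)%:R) <=
  decay * keep u c.
Proof.
apply: le_trans (ler_expect activation_ge0 (uncoloured_revealed c)) _.
rewrite expectB expect_Z expect_sum.
have kp0 : 0 <= kp c.
  apply: prodr_ge0 => w _; rewrite subr_ge0 (le_trans (hit_le_de _ _ _)) //.
  by move: de1; lra.
apply: le_trans (_ : kp c - \sum_x nk x v g * (al * p u x * (kp c * (1 - 2 * de)))
   <= _).
  rewrite lerD2l lerN2; apply: ler_sum => x _; rewrite expectZ ler_wpM2l //.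
  exact: expect_Y_ge.
rewrite (eq_bigr (fun x => al * (kp c * (1 - 2 * de)) * (nk x v g * p u x))); last first.
  by move=> x _; ring.
rewrite -mulr_sumr.
(* The one revealed colour kills weight at most [D * P <= de / 2] at [u]. *)
have nkp : 1 - de / 2 <= \sum_x nk x v g * p u x.
  have -> : \sum_x nk x v g * p u x = 1 - \sum_x (kills u x v g)%:R * p u x.
    rewrite -[X in X - _](_ : \sum_x p u x = 1); last by rewrite (p_sum st) Uu.
    rewrite -sumrB; apply: eq_bigr => x _; rewrite /nk.
    by case: (kills u x v g); rewrite /= ?mul0r ?mul1r ?subrr ?subr0.
  rewrite lerD2l lerN2; case: g => [y|] /=; last first.
    by rewrite big1 ?divr_ge0 ?ltW // => x _; rewrite mul0r.
  apply: le_trans DP; apply: le_trans (K_p_sum v y u).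
  by apply: ler_sum => x _; rewrite K_sym.
(* [kp c] lacks only the factor of [v] in [keep u c], and this is at least [1 - al * (de / 2)]. *)
rewrite /keep (bigD1 v) //= -/(kp c).
set S := \sum_x _ in nkp *.
have hv : hit u c v <= al * (de / 2).
  by apply: le_trans (hit_le_DP u c v) _; rewrite ler_wpM2l // ltW.
have -> : kp c - al * (kp c * (1 - 2 * de)) * S =
    kp c * (1 - al * (1 - 2 * de) * S) by ring.
rewrite [leRHS]mulrA [leRHS]mulrC ler_wpM2l //.
have a0 := ltW al0; have d0 := ltW de0; have d1 := de1; have a1 := al1.
have aS : al * (1 - 2 * de) * (1 - de / 2) <= al * (1 - 2 * de) * S.
  by rewrite ler_wpM2l // mulr_ge0 //; lra.
have dec : decay * (1 - al * (de / 2)) <= decay * (1 - hit u c v).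
  rewrite ler_wpM2l //; first by rewrite /decay; nra.
  by rewrite lerD2l lerN2.
apply: le_trans dec; rewrite /decay.
have ad : 0 <= al * de by rewrite mulr_ge0.
have add : 0 <= al * de * de by rewrite mulr_ge0.
have aad : al * (al * de) <= al * de by rewrite ler_piMl //; lra.
have aadd : 0 <= al * al * de * de by rewrite !mulr_ge0.
have : al * de * de <= al * de * 10%:R^-1 by rewrite ler_wpM2l.
nra.
Qed.

End Revealed.
Lemma decay_ge0 : 0 <= decay.
Proof. by rewrite /decay; have := al0; have := al1; have := de0; nra. Qed.

Lemma expect_load_from v c u (g : option C) :
  expect mu (fun om => load_from (update om v g) v c u) <=
  decay * \sum_x (K v c u x)%:R * p u x.
Proof.
rewrite /load_from; under eq_expect do rewrite mulr_sumr.
rewrite expect_sum mulr_sumr; apply: ler_sum => x _.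
case Kx: (K v c u x); last first.
  rewrite mul0r mulr0 -(expect_cst activation_sum 0).
  by apply: ler_expect => [|om]; [exact: activation_ge0|rewrite mul0r mulr0].
rewrite mul1r; case Uu: (U u); last first.
  have p0 : p u x = 0.
    apply/eqP; have /eqP := p_sum st u; rewrite Uu psumr_eq0 => [/allP|y _].
      by move=> /(_ x); rewrite mem_index_enum => /(_ isT).
    exact: p_ge0 st u y.
  rewrite p0 mulr0 -(expect_cst activation_sum 0).
  apply: ler_expect => [|om]; first exact: activation_ge0.
  by rewrite /reweighted p0 !mul0r !mulr0.
apply: le_trans (_ : p u x / keep u x * (decay * keep u x) <= _); last first.
  by rewrite mulrCA -mulrA mulVf ?mulr1 // gt_eqF ?keep_gt0.
apply: le_trans (_ : p u x / keep u x * expect mu (fun om =>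
   (survives (update om v g) u x && ~~ coloured (update om v g) u)%:R) <= _).
  rewrite -expectZ; apply: ler_expect => [|om]; first exact: activation_ge0.
  rewrite mul1r /reweighted mulrCA -mulnb natrM [_%:R * _]mulrC.
  by rewrite le_eqVlt eqxx.
by rewrite ler_wpM2l ?p_keep_ge0 // expect_uncoloured // (K_adj Kx).
Qed.

(** * Upper tail of the loads *)

Section UpperTail.
Variables (v : V) (c : C) (s : R).
Hypothesis s0 : 0 <= s.
Hypothesis sB : s * B <= 2^-1.

Let b := 1 + 2 * (s * B).

Let b0 : 0 <= b.
Proof. by rewrite /b addr_ge0 // mulr_ge0 // mulr_ge0 // ltW. Qed.

Lemma upper_mgf_vertex u (g : option C) :
  expect mu (fun om => expR (s * load_from (update om v g) v c u)) <=
  expR (b * (s * (decay * \sum_x (K v c u x)%:R * p u x))).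
Proof.
apply: le_trans (_ : expect mu (fun om =>
  1 + b * s * load_from (update om v g) v c u) <= _).
  apply: ler_expect => [|om]; first exact: activation_ge0.
  by rewrite -mulrA expR_mul_le_linear ?load_from_ge0 ?load_from_le.
rewrite expectD (expect_cst activation_sum) expectZ.
apply: le_trans (expR_ge1Dx _); rewrite lerD2l mulrA.
by rewrite ler_wpM2l ?mulr_ge0 // expect_load_from.
Qed.

(* Without cycles of length 3 and 4, the sets [nbhd u :\ v], for [u] adjacent to
   [v], are disjoint; so, once the choice of [v] is revealed, the loads coming
   from distinct neighbours are independent. *)
Lemma nbhd_disjoint u u' : adj v u -> adj v u' -> u != u' ->
  [disjoint (nbhd u :\ v)%SET & (nbhd u' :\ v)%SET].
Proof.
move=> vu vu' uu'; rewrite -finset.setI_eq0; apply/eqP/setP => z; rewrite !inE.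
apply/negP => /andP[/andP[zv /orP[/eqP zu|uz]] /andP[_ /orP[/eqP zu'|u'z]]].
- by rewrite -zu -zu' eqxx in uu'.
- by rewrite zu in u'z; apply: (no3 vu' u'z); rewrite adj_sym.
- by rewrite zu' in uz; apply: (no3 vu uz); rewrite adj_sym.
- rewrite adj_sym in u'z; rewrite adj_sym in vu'.
  by apply: (no4 vu uz u'z vu') => //; rewrite eq_sym.
Qed.

Lemma upper_mgf : expect mu (fun om => expR (s * new_load om v c)) <=
  expR (b * (s * (decay * T))).
Proof.
(* The target does not depend on the choice [g] of [v], so averaging over [g] costs nothing. *)
rewrite (expect_update activation_sum v).
apply: le_trans (_ : \sum_g mu v g * expR (b * (s * (decay * T))) <= _); last first.
  by rewrite -mulr_suml activation_sum mul1r.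
apply: ler_sum => g _; rewrite ler_wpM2l ?activation_ge0 //.
pose r := enum [pred u | adj v u].
have rE (F : V -> R) : (forall u, ~~ adj v u -> F u = 0) ->
    \sum_u F u = \sum_(u <- r) F u.
  move=> F0; rewrite big_enum [RHS]big_mkcond /=; apply: eq_bigr => u _.
  by case: ifP => // /negbT; rewrite inE => /F0.
have -> : (fun om : conf => expR (s * new_load (update om v g) v c)) =
    (fun om => \prod_(u <- r) expR (s * load_from (update om v g) v c u)).
  apply/funext => om; rewrite -expR_sum -mulr_sumr /new_load rE // => u.
  exact: load_from_nadj.
have rP u : u \in r -> adj v u by rewrite mem_enum.
rewrite (expect_prod activation_sum (S := fun u => (nbhd u :\ v)%SET)).
- apply: le_trans (_ : \prod_(u <- r)
      expR (b * (s * (decay * \sum_x (K v c u x)%:R * p u x))) <= _).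
    apply: ler_prod => u _; rewrite upper_mgf_vertex andbT.
    by apply: expect_ge0 => [|om]; [exact: activation_ge0|exact: expR_ge0].
  rewrite -expR_sum ler_expR -!mulr_sumr !ler_wpM2l ?decay_ge0 //.
  rewrite -rE ?(p_load st) // => u nvu; rewrite big1 // => x _.
  by rewrite (contraNF (@K_adj v c u x) nvu) mul0r.
- exact: enum_uniq.
- move=> u _ om om' eqo; congr (expR (s * _)); apply: load_from_nbhd => w wu.
  rewrite !ffunE; case: (boolP (w == v)) => // wv.
  by apply: eqo; rewrite !inE wv /=; move: wu; rewrite inE.
- by move=> u u' /rP vu /rP vu' uu'; apply: nbhd_disjoint.
Qed.

End UpperTail.

Lemma prob_new_load_big v c : 32%:R^-1 <= decay * T ->
  prob mu (fun om => (1 + eta) * (decay * T) <= new_load om v c) <=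
  expR (- (eta ^+ 2 / (256%:R * B))).
Proof.
move=> m32; set m := decay * T in m32 *.
(* With [s * B = eta / 4] the mean is inflated by [1 + eta / 2] only; the rest of the deviation and
   [m >= 1/32] give 256 = 4 * 2 * 32. *)
pose s := eta / (4%:R * B); have s0 : 0 <= s by rewrite divr_ge0 ?mulr_ge0 // ltW.
have sBe : s * B = eta / 4%:R by rewrite /s; field; rewrite gt_eqF.
have sB : s * B <= 2^-1 by rewrite sBe; move: eta1; lra.
apply: le_trans (_ : expR (- (s * ((1 + eta) * m))) *
   expect mu (fun om => expR (s * new_load om v c)) <= _).
  apply: markov_exp => [|om le]; first exact: activation_ge0.
  by rewrite ler_wpM2l.
apply: le_trans (_ : expR (- (s * ((1 + eta) * m))) *
   expR ((1 + 2 * (s * B)) * (s * m)) <= _).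
  by rewrite ler_wpM2l ?expR_ge0 // upper_mgf.
rewrite -expRD ler_expR.
have -> : eta ^+ 2 / (256%:R * B) = s * (eta / 2) * 32%:R^-1.
  by rewrite /s; field; rewrite gt_eqF.
have : s * (eta / 2) * 32%:R^-1 <= s * (eta / 2) * m.
  by rewrite ler_wpM2l // mulr_ge0 // divr_ge0 // ltW.
rewrite sBe; nra.
Qed.

(** * Good outcomes at all vertices at once *)

Definition ball2 v : {set V} := \bigcup_(u in nbhd v) nbhd u.

Definition bad v : pred conf := fun om =>
  (U v && (total om v < 1 - eta)) ||
  [exists c, (1 + eta) * (decay * T) <= new_load om v c].

Lemma bad_ball2 v : depends_on (ball2 v) (bad v).
Proof.
move=> om om' eqo; have eqn u : u \in nbhd v -> {in nbhd u, om =1 om'}.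
  by move=> uv w wu; apply: eqo; apply/bigcupP; exists u.
rewrite /bad (total_nbhd (eqn v _)) ?inE ?eqxx //; congr (_ || _).
apply: eq_existsb => c; congr (_ <= _); apply: eq_bigr => u _.
case: (boolP (adj v u)) => vu; last by rewrite !load_from_nadj.
by apply: (load_from_nbhd _ _ (eqn u _)); rewrite inE vu orbT.
Qed.

Lemma prob_bad v : 32%:R^-1 <= decay * T ->
  prob mu (bad v) <= (1 + #|C|%:R) * expR (- (eta ^+ 2 / (256%:R * B))).
Proof.
move=> m32; set e := expR _.
apply: le_trans (_ : prob mu (fun om => U v && (total om v < 1 - eta)) +
  prob mu (fun om => [exists c, (1 + eta) * (decay * T) <= new_load om v c]) <= _).
  rewrite -expectD; apply: ler_expect => [|om]; first exact: activation_ge0.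
  by rewrite /bad; case: (U v && _); case: [exists _, _]; rewrite -natrD ler_nat.
rewrite (_ : (1 + #|C|%:R) * e = e + #|C|%:R * e); last first.
  by rewrite mulrDl mul1r.
apply: lerD.
  case: (boolP (U v)) => [Uv|_]; last first.
    apply: (@le_trans _ _ 0); last exact: expR_ge0.
    rewrite -(expect_cst activation_sum 0).
    by apply: ler_expect => [|om]; [exact: activation_ge0|rewrite lexx].
  apply: le_trans (prob_total_small Uv) _; rewrite ler_expR lerN2.
  rewrite ler_wpM2l ?sqr_ge0 // lef_pV2 ?posrE ?mulr_gt0 //.
  by have := B0; lra.
apply: le_trans (prob_has activation_ge0 _) _.
apply: le_trans (_ : \sum_(c : C) e <= _).
  by apply: ler_sum => c _; apply: prob_new_load_big.
by rewrite sumr_const -[leLHS]mulr_natl lexx.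
Qed.

Lemma card_bigcup_le (A : {set V}) (F : V -> {set V}) (m : nat) :
  (forall v, #|F v| <= m)%N -> (#|\bigcup_(v in A) F v| <= #|A| * m)%N.
Proof.
move=> Fm; apply: leq_trans (_ : \sum_(v in A) #|F v| <= _)%N.
  elim/big_rec2: _ => [|v S n _ IH]; first by rewrite cards0.
  apply: leq_trans (leq_card_setU _ _) _; by rewrite leq_add2l.
by rewrite -sum_nat_const leq_sum.
Qed.

Lemma nbhd_sym u v : (u \in nbhd v) = (v \in nbhd u).
Proof. by rewrite !inE eq_sym adj_sym. Qed.

Lemma ball2_sym u v : (u \in ball2 v) = (v \in ball2 u).
Proof.
by apply/bigcupP/bigcupP => -[w wv uw]; exists w; rewrite 1?nbhd_sym // -nbhd_sym.
Qed.

Lemma card_ball2 v : (#|ball2 v| <= nd ^ 2)%N.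
Proof.
apply: leq_trans (card_bigcup_le _ deg) _.
by rewrite -mulnn leq_mul2r deg orbT.
Qed.

(** If the two balls meet, [w] is within distance four of [v]. *)
Lemma card_ball2_meet v :
  (#|[set w | (w == v) || ~~ [disjoint ball2 w & ball2 v]]%SET| <= nd ^ 4)%N.
Proof.
apply: leq_trans (_ : #|\bigcup_(z in ball2 v) ball2 z| <= _)%N; last first.
  apply: leq_trans (card_bigcup_le _ card_ball2) _.
  by rewrite (expnD nd 2 2) leq_mul2r card_ball2 orbT.
have self w : w \in ball2 w by apply/bigcupP; exists w; rewrite !inE eqxx.
apply/subset_leq_card/fintype.subsetP => w; rewrite inE => /orP[/eqP->|].
  by apply/bigcupP; exists v.
rewrite -finset.setI_eq0 => /set0Pn[z]; rewrite inE => /andP[zw zv].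
by apply/bigcupP; exists z => //; rewrite ball2_sym.
Qed.

Lemma nibble_outcome : 32%:R^-1 <= decay * T ->
  (nd ^ 4)%:R * ((1 + #|C|%:R) * expR (- (eta ^+ 2 / (256%:R * B)))) <= 4%:R^-1 ->
  exists om, 0 < weight mu om /\ forall v, ~~ bad v om.
Proof.
move=> m32 small; apply: (local_lemma activation_ge0 activation_sum bad_ball2) => v.
apply: le_trans small.
apply: le_trans (_ : \sum_(w | (w == v) || ~~ [disjoint ball2 w & ball2 v])
  ((1 + #|C|%:R) * expR (- (eta ^+ 2 / (256%:R * B)))) <= _).
  by apply: ler_sum => w _; apply: prob_bad.
rewrite sumr_const -[leLHS]mulr_natl ler_wpM2r //.
by rewrite ler_nat; apply: leq_trans (card_ball2_meet v); rewrite cardsE.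
Qed.

(** By [32 * eta <= al * de], the deviations [eta] are absorbed by one extra [de]: [2 * de] instead
    of [de] for weights, [5 * de] instead of [4 * de] for loads. *)
Lemma nibble_step : 16%:R^-1 <= T -> 32%:R * eta <= al * de ->
  (nd ^ 4)%:R * ((1 + #|C|%:R) * expR (- (eta ^+ 2 / (256%:R * B)))) <= 4%:R^-1 ->
  exists U' p', state (P * expR ((1 + 2 * de) * (al * T)))
      (T - (1 - 5%:R * de) * (al * T)) U' p' /\
    (solvable U' p' -> solvable U p).
Proof.
move=> T16 eta_al small.
have a0 := al0; have a1 := al1; have d0 := de0; have d1 := de1; have e0 := eta0.
have dT : decay <= 1 by rewrite /decay; nra.
have m32 : 32%:R^-1 <= decay * T.
  have : 2^-1 <= decay.
    by rewrite /decay; nra.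
  have := decay_ge0; nra.
have [om [w0 good]] := nibble_outcome m32 small.
have tot v : U v -> 1 - eta <= total om v.
  move=> Uv; have := good v; rewrite /bad negb_or Uv /= => /andP[].
  by rewrite -leNgt.
have load v c : new_load om v c <= (1 + eta) * (decay * T).
  have := good v; rewrite /bad negb_or => /andP[_ /existsPn/(_ c)].
  by rewrite -ltNge => /ltW.
have eta1' : 0 < 1 - eta by have := eta1; lra.
pose U' := [pred v | U v && ~~ coloured om v].
pose p' v c := (U' v)%:R * (reweighted om v c / total om v).
have tot0 v : U v -> 0 < total om v by move=> /tot; apply: lt_le_trans.
have p'0 v c : 0 <= p' v c.
  rewrite /p' /=; case: (boolP (U v)) => [Uv|_]; last by rewrite mul0r.
  by rewrite mulr_ge0 // divr_ge0 ?reweighted_ge0 // ltW ?tot0.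
exists U', p'; split; last first.
  move=> [sg [sg_pos sg_ok]].
  pose sigma v := if om v is Some x then if survives om v x then x else sg v
    else sg v.
  have sigma_col v : coloured om v -> om v = Some (sigma v).
    by rewrite /coloured /sigma; case: (om v) => // x ->.
  have sigma_unc v : ~~ coloured om v -> sigma v = sg v.
    by rewrite /coloured /sigma; case: (om v) => // x /negbTE ->.
  (* An activated colour has positive weight because [om] has; elsewhere a positive new weight
     forces survival and a positive old weight. *)
  have sigma_sv v : U v -> survives om v (sigma v) && (0 < p v (sigma v)).
    move=> Uv; case: (boolP (coloured om v)) => cv.
      have omv := sigma_col v cv; move: (cv); rewrite /coloured omv => -> /=.
      rewrite lt_def (p_ge0 st) andbT; apply: contraTneq w0 => p0.
      by rewrite /weight (bigD1 v) //= omv /= p0 mulr0 mul0r ltxx.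
    have U'v : U' v by rewrite /= Uv cv.
    have := sg_pos v U'v; rewrite /p' U'v mul1r -sigma_unc //.
    rewrite (pmulr_lgt0 _ (_ : 0 < (total om v)^-1)) ?invr_gt0 ?tot0 //.
    rewrite /reweighted; case: (survives om v (sigma v)); last by rewrite mulr0 ltxx.
    by rewrite mulr1 pmulr_lgt0 // invr_gt0 keep_gt0.
  have no_conflict u v : U v -> coloured om u -> ~~ K v (sigma v) u (sigma u).
    move=> Uv cu; have /andP[/forallP/(_ u) + _] := sigma_sv v Uv.
    by rewrite (sigma_col u cu).
  exists sigma; split=> [v /sigma_sv/andP[] //|u v Uu Uv].
  case: (boolP (coloured om u)) => cu; first exact: no_conflict.
  case: (boolP (coloured om v)) => cv; first by rewrite K_sym no_conflict.
  by rewrite !sigma_unc //; apply: sg_ok; rewrite /= ?Uu ?Uv.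
have T0 : 0 < T by apply: lt_le_trans T16.
split=> //.
- move=> v; rewrite -mulr_sumr -mulr_suml -/(total om v) /=.
  case: (boolP (U v)) => [Uv|_]; last by rewrite mul0r.
  by rewrite divff ?mulr1 // gt_eqF ?tot0.
- move=> v c; set x := al * T; have x0 : 0 < x by rewrite mulr_gt0.
  have P0 := P_ge0 v c.
  rewrite /p' /=; case: (boolP (U v)) => [Uv|_]; last by rewrite mul0r mulr_ge0 ?expR_ge0.
  apply: le_trans (_ : reweighted om v c / total om v <= _).
    by rewrite ler_piMl ?lern1 ?leq_b1 // divr_ge0 ?reweighted_ge0 // ltW ?tot0.
  rewrite ler_pdivrMr ?tot0 //; apply: le_trans (reweighted_le om v c) _.
  have -> : (1 + 2 * de) * x = (1 + de) * x + de * x by ring.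
  rewrite expRD; set E1 := expR _; set E2 := expR _; set S := total om v.
  have -> : P * (E1 * E2) * S = P * E1 * (E2 * S) by ring.
  apply: le_trans (_ : P * E1 <= _).
    rewrite ler_pdivrMr ?keep_gt0 //; apply: le_trans (p_le st v c) _.
    rewrite -mulrA ler_peMr // -[leLHS](expRxMexpNx_1 ((1 + de) * x)).
    by rewrite ler_wpM2l ?expR_ge0 // keep_ge_exp.
  rewrite ler_peMr ?mulr_ge0 ?expR_ge0 //.
  rewrite /E2 /S; have e2 : 1 + de * x <= expR (de * x) := expR_ge1Dx _.
  (* From [T >= 1/16]; this lets [expR (de * x)] make up for dividing by [total], which may be as
     small as [1 - eta]. *)
  have dx : 2 * eta <= de * x.
    have : al * de * 16%:R^-1 <= al * de * T by rewrite ler_wpM2l // mulr_ge0 // ltW.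
    by rewrite /x; nra.
  have ht := tot v Uv; have eh := eta1.
  apply: le_trans (_ : (1 + de * x) * (1 - eta) <= _); first by nra.
  by apply: ler_pM => //; [nra|exact: ltW].
- move=> v c; apply: le_trans (_ : new_load om v c / (1 - eta) <= _).
    rewrite /colour_load /new_load mulr_suml; apply: ler_sum => u _.
    rewrite /load_from mulr_sumr mulr_suml; apply: ler_sum => x _.
    rewrite [X in _ <= X / _]mulrCA -[leRHS]mulrA ler_wpM2l // /p' /=.
    case: (boolP (U u)) => [Uu|_]; last first.
      by rewrite mul0r divr_ge0 ?(mulr_ge0 _ (reweighted_ge0 _ _ _)) // ltW.
    rewrite /= -[leRHS]mulrA ler_wpM2l // ler_wpM2l ?reweighted_ge0 //.
    by rewrite lef_pV2 ?posrE ?tot // tot0.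
  rewrite ler_pdivrMr //; apply: le_trans (load v c) _.
  have -> : (1 + eta) * (decay * T) = T * ((1 + eta) * decay) by ring.
  have -> : (T - (1 - 5%:R * de) * (al * T)) * (1 - eta) =
    T * ((1 - (1 - 5%:R * de) * al) * (1 - eta)) by ring.
  rewrite ler_wpM2l ?(ltW T0) // /decay.
  have : 0 <= eta * (al * (2 - 9%:R * de)).
    by rewrite mulr_ge0 ?mulr_ge0 ?ltW //; lra.
  nra.
Qed.

End Step.

(** * Colouring at small load, and iteration of the step *)

Lemma state_small_solvable (c0 : C) P T U p :
  state P T U p -> 0 <= T -> T <= 16%:R^-1 -> solvable U p.
Proof.
move=> st T0 T16.
(* Each vertex of [U] draws its colour from [p]; the events to avoid are conflicts between pairs of
   vertices. *)
pose mu v (o : option C) : R := if o is Some c then p v c else 1 - (U v)%:R.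
have mu0 v o : 0 <= mu v o.
  case: o => [c|] /=; first exact: p_ge0 st v c.
  by rewrite subr_ge0 lern1 leq_b1.
have mu1 v : \sum_o mu v o = 1.
  by rewrite big_option /= (p_sum st) subrK.
pose A (i : V * V) : pred {ffun V -> option C} := fun om =>
  [exists e : C * C, [&& K i.1 e.1 i.2 e.2, om i.1 == Some e.1 & om i.2 == Some e.2]].
pose q v u := \sum_c \sum_x (K v c u x)%:R * (p v c * p u x).
have pA i : prob mu (A i) <= q i.1 i.2.
  rewrite /q pair_bigA; apply: le_trans (prob_has mu0 _) _; apply: ler_sum => e _.
  case: i => v u /=; case Ke: (K _ _ _ _); last first.
    by rewrite mul0r -(expect_cst mu1 0); apply: ler_expect => [|om] //; rewrite lexx.
  have vu : u != v by apply: contraTneq (K_adj Ke) => ->; rewrite adj_irr.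
  have coord w c : expect mu (fun om => (om w == Some c)%:R) = p w c.
    rewrite (expect_coord mu1 w (fun o => (o == Some c)%:R)) (bigD1 (Some c)) //=.
    rewrite eqxx mulr1 big1 ?addr0 // => o oc.
    by rewrite (negbTE oc) mulr0.
  rewrite mul1r -!coord -(expect_indep mu1 (S := [set v]%SET)).
  - by apply: ler_expect => [|om] //; rewrite -natrM mulnb.
  - by move=> om om' /(_ v) ->; rewrite ?inE.
  - by move=> om om' /(_ u) ->; rewrite ?inE.
have q_sum v : \sum_u q v u <= T.
  apply: le_trans (_ : \sum_c p v c * T <= _).
    rewrite exchange_big; apply: ler_sum => c _ /=.
    apply: le_trans (_ : p v c * colour_load p v c <= _); last first.
      by rewrite ler_wpM2l ?(p_ge0 st) ?(p_load st).
    rewrite /colour_load mulr_sumr; apply: ler_sum => u _; rewrite mulr_sumr.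
    by apply: ler_sum => x _; rewrite mulrCA.
  rewrite -mulr_suml (p_sum st); by case: (U v); rewrite ?mul1r ?mul0r.
have q_sym v u : q v u = q u v.
  rewrite /q exchange_big; apply: eq_bigr => c _; apply: eq_bigr => x _ /=.
  by rewrite K_sym [p v _ * _]mulrC.
have q0 v u : 0 <= q v u.
  by apply: sumr_ge0 => c _; apply: sumr_ge0 => x _; rewrite !mulr_ge0 ?(p_ge0 st).
have [||om [w0 good]] := local_lemma mu0 mu1 (S := fun i => [set i.1; i.2]%SET) (A := A).
- move=> i om om' eqo; apply: eq_existsb => e.
  by rewrite !eqo // !inE eqxx ?orbT.
(* [h] charges an ordered pair to its members equal to [w]. A vertex is charged at most [2 * T], so
   the two vertices [v] and [u] receive at most [4 * T <= 1/4]. *)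
- move=> [v u]; pose h a b w : R := (a == w)%:R * q a b + (b == w)%:R * q b a.
  have hw w : \sum_a \sum_b h a b w <= 2 * T.
    have e1 : \sum_a \sum_b (a == w)%:R * q a b <= T.
      rewrite (bigD1 w) //= [X in _ + X]big1 ?addr0 => [|a aw].
        by under eq_bigr do rewrite eqxx mul1r; exact: q_sum.
      by rewrite big1 // => b _; rewrite (negbTE aw) mul0r.
    have -> : \sum_a \sum_b h a b w = (\sum_a \sum_b (a == w)%:R * q a b) *+ 2.
      rewrite mulr2n -[X in _ = _ + X]exchange_big -big_split.
      by apply: eq_bigr => a _; rewrite -big_split.
    by rewrite mulr2n; lra.
  apply: le_trans (_ : \sum_(i : V * V) (h i.1 i.2 v + h i.1 i.2 u) <= _).
    rewrite big_mkcond; apply: ler_sum => -[a b] _ /=.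
    have h0 w : 0 <= h a b w by rewrite addr_ge0 // mulr_ge0.
    case: ifP => [touch|_]; last by rewrite addr_ge0.
    apply: le_trans (pA _) _ => /=; rewrite /h (q_sym b a) -!mulrDl -!natrD.
    rewrite ler_peMl // ler1n lt0n.
    move: touch; rewrite -finset.setI_eq0; case/orP => [/eqP[-> ->]|/set0Pn[z]].
      by rewrite eqxx.
    rewrite !inE; case/andP => /orP[]/eqP->; case/orP=> /eqP->; rewrite eqxx; lia.
  rewrite -(pair_bigA _ (fun a b => h a b v + h a b u)) /=.
  under eq_bigr do rewrite big_split /=.
  by rewrite big_split /=; have := hw v; have := hw u; lra.
have wpos v : 0 < mu v (om v).
  rewrite lt_def mu0 andbT; apply: contraTneq w0 => p0.
  by rewrite /weight (bigD1 v) //= p0 mul0r ltxx.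
have some v : U v -> exists2 c, om v = Some c & 0 < p v c.
  move=> Uv; move: (wpos v); rewrite /mu; case: (om v) => [c|]; last first.
    by rewrite Uv subrr ltxx.
  by exists c.
(* The default [c0] is reached only outside [U]. *)
exists (fun v => odflt c0 (om v)); split=> [v /some[c -> //]|u v Uu Uv].
have [c omu _] := some u Uu; have [x omv _] := some v Uv; rewrite omu omv /=.
apply/negP => Kvu; have /negP[] := good (v, u); apply/existsP; exists (x, c).
by rewrite /= Kvu omu omv !eqxx.
Qed.

(** A step leaves [P * expR (la * T)] unchanged, so [Q] bounds the weights throughout and the same
    parameters serve every step. While [T >= 1/16], a step lowers [T] by at least [al / 32], hence
    the count [n]. *)
Lemma nibble_iter (al de B eta Q : R) (n : nat) (c0 : C) P T U p :
  0 < al -> al <= 2^-1 -> 0 < de -> de <= 10%:R^-1 -> 0 < B ->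
  0 < eta -> eta <= 2^-1 -> 32%:R * eta <= al * de ->
  (nd ^ 4)%:R * ((1 + #|C|%:R) * expR (- (eta ^+ 2 / (256%:R * B)))) <= 4%:R^-1 ->
  0 <= D -> D * Q <= de / 2 -> 2 * (D * Q) <= B ->
  0 <= P -> 0 <= T -> P * expR ((1 + 2 * de) / (1 - 5%:R * de) * T) <= Q -> al * T <= de ->
  T <= 16%:R^-1 + n%:R * (al / 32%:R) ->
  state P T U p -> solvable U p.
Proof.
move=> al0 al1 de0 de1 B0 e0 e1 eal small D0 DQ DQB; set la := (1 + 2 * de) / _.
have la0 : 0 <= la by rewrite divr_ge0 //; lra.
elim: n P T U p => [|n IHn] P T U p P0 T0 PQ alT Tn st.
  by apply: (state_small_solvable c0 st) => //; rewrite mul0r addr0 in Tn.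
have [T16|/ltW T16] := leP T 16%:R^-1; first exact: state_small_solvable st T0 T16.
have PleQ : P <= Q.
  apply: le_trans PQ; rewrite ler_peMr // -expR0 ler_expR mulr_ge0 //.
have DPQ : D * P <= D * Q by rewrite ler_wpM2l.
have [||U' [p' [st' imp]]] := nibble_step st al0 al1 de0 de1 alT _ B0 _ e0 e1 T16 eal small.
- exact: le_trans DQ.
- by apply: le_trans DQB; rewrite ler_wpM2l.
have aT0 : 0 <= al * T by rewrite mulr_ge0 // ltW.
have daT0 : 0 <= (1 - 5%:R * de) * (al * T) by rewrite mulr_ge0 //; lra.
have aT1 : (1 - 5%:R * de) * (al * T) <= al * T by rewrite ler_piMl //; lra.
have aT2 : al * T <= 2^-1 * T by rewrite ler_wpM2r.
apply: imp; apply: IHn st'.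
- by rewrite mulr_ge0 ?expR_ge0.
- lra.
- rewrite -mulrA -expRD; apply: le_trans PQ; rewrite ler_wpM2l // ler_expR.
  rewrite le_eqVlt; apply/orP; left; apply/eqP; rewrite /la; field; lra.
- by apply: le_trans alT; rewrite ler_wpM2l ?(ltW al0) // gerBl.
- have aT3 : 2^-1 * (al * 16%:R^-1) <= (1 - 5%:R * de) * (al * T).
    by apply: ler_pM; rewrite ?mulr_ge0 ?(ltW al0) ?ler_wpM2l ?(ltW al0) //; lra.
  by move: Tn; rewrite -natr1 mulrDl mul1r; lra.
Qed.

End ConflictStructure.

(** * Choice of the parameters *)

Section Asymptotics.
Variable R : realType.

Lemma expR_ge_pow5 (y : R) : 0 <= y -> (y / 5%:R) ^+ 5 <= expR y.
Proof.
move=> y0; have -> : y = 5%:R * (y / 5%:R) by field.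
rewrite expRM_natl; have -> : 5%:R * (y / 5%:R) / 5%:R = y / 5%:R by field.
have z0 : 0 <= y / 5%:R by rewrite divr_ge0.
rewrite lerXn2r ?nnegrE ?expR_ge0 //; apply: le_trans (expR_ge1Dx _).
by rewrite lerDr.
Qed.

Variable eps : R.
Hypothesis eps0 : 0 < eps.

Let s : R := 2 * Num.sqrt 2 + eps.
Let b : R := 1 / 4 * eps ^+ 2 / (eps + 5) ^+ 2.
(** The initial load bound 4 Delta / x^2 is [th * ln Delta]. *)
Let th : R := 4%:R / s ^+ 2.

Lemma sqrt2_bounds : 0 < Num.sqrt 2 :> R /\ Num.sqrt 2 ^+ 2 = 2 :> R.
Proof. by rewrite sqrtr_gt0 sqr_sqrtr // ltr0n. Qed.

Lemma s_bounds : [/\ 2 <= s, 8%:R + eps ^+ 2 < s ^+ 2 & s ^+ 2 <= (eps + 5%:R) ^+ 2].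
Proof.
have [r0 r2] := sqrt2_bounds; have e0 := eps0; rewrite /s.
set r := Num.sqrt 2 in r0 r2 *.
have r1 : 1 <= r by nra.
have r15 : r <= 3%:R / 2 by nra.
split; first lra.
  have : 0 < r * eps by rewrite mulr_gt0.
  by nra.
by rewrite lerXn2r ?nnegrE //; lra.
Qed.

(** Weights start near Delta^(-1/2), grow by about Delta^th and meet a conflict degree up to
    Delta^b. The gap holds since [b] < eps^2 / (2 s^2) < 1/2 - [th]. *)
Lemma exponent_gap : 0 < 2^-1 - th - b.
Proof.
have [s2 s8 s5] := s_bounds; have e0 := eps0.
have ss0 : 0 < s ^+ 2 by rewrite exprn_gt0 //; lra.
have -> : 2^-1 - th - b =
    (s ^+ 2 - 8%:R) / (2 * s ^+ 2) - eps ^+ 2 / (4%:R * (eps + 5%:R) ^+ 2).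
  by rewrite /th /b; field; apply/andP; split; rewrite gt_eqF //; lra.
rewrite subr_gt0; apply: lt_trans (_ : eps ^+ 2 / (2 * s ^+ 2) < _).
  rewrite ltr_pM2l ?exprn_gt0 // ltf_pV2 ?posrE ?mulr_gt0 ?exprn_gt0 //; nra.
by rewrite ltr_pM2r ?invr_gt0 ?mulr_gt0 //; lra.
Qed.

Lemma nibble_parameters : exists Delta0 : nat, forall Delta : nat,
  (Delta0 < Delta)%N ->
  let x : R := s * Num.sqrt (Delta%:R / ln Delta%:R) in
  0 < x /\ forall (l : nat) (D : R), x / 2 <= l%:R -> l%:R <= x / 2 + 1 ->
    0 <= D -> D <= powR Delta%:R b ->
    exists al de B eta Q : R,
      [/\ 0 < al, al <= 2^-1, 0 < de, de <= 10%:R^-1 & 0 < B] /\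
      [/\ 0 < eta, eta <= 2^-1, 32%:R * eta <= al * de &
        (Delta.+1 ^ 4)%:R * ((1 + l%:R) * expR (- (eta ^+ 2 / (256%:R * B)))) <=
          4%:R^-1] /\
      [/\ D * Q <= de / 2, 2 * (D * Q) <= B,
        l%:R^-1 * expR ((1 + 2 * de) / (1 - 5%:R * de) * (4%:R * Delta%:R / x ^+ 2))
          <= Q &
        al * (4%:R * Delta%:R / x ^+ 2) <= de].
Proof.
have [s2 s8 s5] := s_bounds; have gap := exponent_gap; have e0 := eps0.
have ss0 : 0 < s ^+ 2 by rewrite exprn_gt0 //; lra.
have th0 : 0 < th by rewrite divr_gt0.
have th1 : th <= 2^-1.
  by rewrite /th ler_pdivrMr //; have : 0 <= eps ^+ 2 := sqr_ge0 _; lra.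
pose ka := (2^-1 - th - b) / 2; have ka0 : 0 < ka by rewrite /ka; lra.
pose de := Num.min 10%:R^-1 (ka / 7%:R).
have de0 : 0 < de by rewrite lt_min !divr_gt0 // invr_gt0 ltr0n.
have de1 : de <= 10%:R^-1 by rewrite ge_min lexx.
have de7 : 7%:R * de <= ka.
  have : de <= ka / 7%:R by rewrite ge_min lexx orbT.
  by lra.
pose la := (1 + 2 * de) / (1 - 5%:R * de).
have lath : la * th <= 2^-1 - b - ka.
  have : la <= 1 + 14%:R * de by rewrite /la ler_pdivrMr; nra.
  by rewrite /ka in de7 *; nra.
(* [k] collects the constants of [eta ^+ 2 / (256 * B)] for [eta] = de^2 / (32 L) and [B] = 2 Z; [M]
   is such that [M * L ^+ 3 * Z <= 1] makes this quotient at least 10 L. *)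
pose k : R := 32%:R * 32%:R * (256%:R * 2); have k0 : 0 < k by rewrite !mulr_gt0.
have k1 : 1 <= k by rewrite /k; lra.
pose M := 10%:R * k / de ^+ 4; have M0 : 0 < M by rewrite divr_gt0 ?exprn_gt0 ?mulr_gt0.
pose L0 := 128%:R + s ^+ 2 + M * (5%:R / ka) ^+ 5.
exists (Num.truncn (expR L0)).+1 => Delta Delta_big x.
have L0_Delta : expR L0 <= Delta%:R.
  apply: ltW; apply: lt_trans (truncnS_gt _) _; by rewrite ltr_nat.
have Delta_gt0 : 0 < Delta%:R :> R by apply: lt_le_trans L0_Delta; exact: expR_gt0.
have [L DeltaE] : exists L : R, Delta%:R = expR L.
  by exists (ln Delta%:R); rewrite lnK.
have lnE : ln Delta%:R = L by rewrite DeltaE expRK.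
have LL0 : L0 <= L by rewrite -ler_expR -DeltaE.
have M50 : 0 <= M * (5%:R / ka) ^+ 5.
  by rewrite mulr_ge0 ?(ltW M0) // exprn_ge0 // divr_ge0 // ltW.
have L128 : 128%:R <= L by rewrite /L0 in LL0; lra.
have Ls : s ^+ 2 <= L by rewrite /L0 in LL0; lra.
have LM : M * (5%:R / ka) ^+ 5 <= L by rewrite /L0 in LL0; lra.
have L_gt0 : 0 < L by lra.
have main : M * L ^+ 4 <= expR (ka * L).
  apply: le_trans (expR_ge_pow5 _); last by rewrite mulr_ge0 ?ltW.
  have -> : (ka * L / 5%:R) ^+ 5 = (ka / 5%:R) ^+ 5 * L * L ^+ 4 by ring.
  rewrite ler_wpM2r ?exprn_ge0 ?(ltW L_gt0) //.
  have -> : M = (ka / 5%:R) ^+ 5 * (M * (5%:R / ka) ^+ 5).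
    by field; rewrite gt_eqF.
  by rewrite ler_wpM2l // exprn_ge0 // divr_ge0 // ltW.
have xx : x ^+ 2 = s ^+ 2 * expR L / L.
  rewrite /x lnE DeltaE exprMn sqr_sqrtr ?mulrA // divr_ge0 ?expR_ge0 //; lra.
have x0 : 0 < x.
  rewrite mulr_gt0 //; first lra.
  by rewrite sqrtr_gt0 lnE DeltaE divr_gt0 ?expR_gt0.
split=> // l D lx1 lx2 D0 DD.
have l0 : 0 < l%:R :> R by lra.
have TE : 4%:R * Delta%:R / x ^+ 2 = th * L.
  rewrite xx DeltaE /th; field; rewrite !gt_eqF ?expR_gt0 //; lra.
have DE : D <= expR (b * L) by rewrite /powR DeltaE gt_eqF ?expR_gt0 // expRK in DD.
pose Z := L * expR (- (ka * L)).
have Z0 : 0 < Z by rewrite mulr_gt0 ?expR_gt0.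
have eZ : expR (ka * L) * Z = L.
  by rewrite mulrCA -expRD addrN expR0 mulr1.
(* The initial weight is at most 2 / x <= L [expR (- (L / 2))]; the rest of [Q] is the growth
   [expR (la * T)]. *)
pose Q := L * expR (- (L / 2) + la * (th * L)).
have DQ : D * Q <= Z.
  rewrite /Q /Z mulrCA ler_wpM2l ?(ltW L_gt0) //.
  apply: le_trans (_ : expR (b * L) * expR (- (L / 2) + la * (th * L)) <= _).
    by rewrite ler_wpM2r ?expR_ge0.
  rewrite -expRD ler_expR; nra.
clearbody Z; exists (de / L), de, (2 * Z), (de ^+ 2 / (32%:R * L)), Q.
have etaE : de / L * de = 32%:R * (de ^+ 2 / (32%:R * L)).
  by field; rewrite gt_eqF.
have ML4 : L * (M * L ^+ 3) * Z <= L.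
  apply: le_trans (_ : expR (ka * L) * Z <= _); last by rewrite eZ.
  by rewrite ler_wpM2r ?(ltW Z0) //; apply: le_trans main; nra.
have MZ : M * L ^+ 3 * Z <= 1.
  by rewrite -(ler_pM2l L_gt0) mulr1 mulrA.
have Mde : 2 <= M * de.
  have -> : M * de = 10%:R * k / de ^+ 3 by rewrite /M; field; rewrite gt_eqF.
  rewrite ler_pdivlMr ?exprn_gt0 //.
  have : de ^+ 3 <= 1 by rewrite exprn_ile1 // ?ltW //; lra.
  lra.
have E1L : 1 + L <= expR L := expR_ge1Dx L.
have xE : x <= expR L.
  rewrite -(@ler_pXn2r _ 2) ?nnegrE ?expR_ge0 ?(ltW x0) // xx ler_pdivrMr //.
  by nra.
have xlow : 2 * expR (L / 2) <= x * L.
  have x2 : 0 <= 2 * expR (L / 2) by rewrite mulr_ge0 ?expR_ge0.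
  have xL0 : 0 <= x * L := mulr_ge0 (ltW x0) (ltW L_gt0).
  rewrite -(@ler_pXn2r _ 2) ?nnegrE //.
  have -> : (2 * expR (L / 2)) ^+ 2 = 4%:R * expR L.
    by rewrite exprMn -expRM_natl mulrCA divff ?mulr1 // -natrX.
  have -> : (x * L) ^+ 2 = s ^+ 2 * L * expR L.
    by rewrite (exprMn _ x L) xx; field; rewrite gt_eqF.
  by rewrite ler_wpM2r ?expR_ge0 //; nra.
have ZZ : 2 * Z <= de.
  have L3 : 1 <= L ^+ 3 by rewrite exprn_ege1 //; lra.
  have : M * Z <= M * L ^+ 3 * Z.
    by rewrite ler_wpM2r ?(ltW Z0) // ler_peMr // ltW.
  have : 2 * Z <= M * de * Z by rewrite ler_wpM2r ?(ltW Z0).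
  by nra.
split.
  split=> //; rewrite ?divr_gt0 ?mulr_gt0 //.
  by rewrite ler_pdivrMr //; nra.
split.
  split; rewrite ?divr_gt0 ?exprn_gt0 ?mulr_gt0 //.
  - rewrite ler_pdivrMr ?mulr_gt0 //; nra.
  - by rewrite etaE.
  set y := _ / (256%:R * _).
  have y10 : 10%:R * L <= y.
    have yE : y = de ^+ 4 / (k * L ^+ 2 * Z).
      by rewrite /y /k; field; rewrite !gt_eqF.
    rewrite yE ler_pdivlMr ?mulr_gt0 ?exprn_gt0 //.
    have d4 : 0 < de ^+ 4 by rewrite exprn_gt0.
    have -> : 10%:R * L * (k * L ^+ 2 * Z) = M * L ^+ 3 * Z * de ^+ 4.
      by rewrite /M; field; rewrite gt_eqF.
    by rewrite ler_piMl // ltW.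
  rewrite natrX -natr1 DeltaE.
  (* Delta + 1 and 1 + [l] are both at most [2 * expR L], so 32 [expR (- (5 * L))] is left. *)
  apply: le_trans (_ : (2 * expR L) ^+ 4 * (2 * expR L * expR (- (10%:R * L))) <= _).
    apply: ler_pM; rewrite ?exprn_ge0 ?mulr_ge0 ?addr_ge0 ?expR_ge0 //.
      by rewrite lerXn2r ?nnegrE ?mulr_ge0 ?addr_ge0 ?expR_ge0 //; lra.
    apply: ler_pM; rewrite ?addr_ge0 ?expR_ge0 //; first by lra.
    by rewrite ler_expR lerN2.
  have -> : (2 * expR L) ^+ 4 * (2 * expR L * expR (- (10%:R * L))) =
      32%:R * (expR L ^+ 5 * expR (- (10%:R * L))) by ring.
  rewrite -expRM_natl -expRD (_ : _ + _ = - (5%:R * L)); last by ring.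
  have e5 : 128%:R <= expR (5%:R * L).
    by apply: le_trans (expR_ge1Dx _); lra.
  rewrite expRN mulrC ler_pdivrMl ?expR_gt0 //; lra.
split=> //.
- by apply: le_trans DQ _; lra.
- by rewrite ler_wpM2l.
- rewrite TE -/la /Q expRD [leRHS]mulrA ler_wpM2r ?expR_ge0 //.
  rewrite expRN mulrC ler_pdivlMl ?expR_gt0 // ler_pdivrMr //.
  by nra.
- rewrite TE; have -> : de / L * (th * L) = de * th by field; rewrite gt_eqF.
  nra.
Qed.

End Asymptotics.

(** * Conflicts of a multigraph *)

Section MultigraphReduction.
Variables (G : multigraph) (tau : edge_labelling G).
Local Notation V := (vertex G).

(** Meaningful when [v] is an end of [e]: any vertex but the first is treated as the second. *)
Definition colour_at (e : edge G) v : nat :=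
  if (orient tau e).1 == v then (label tau e).1 else (label tau e).2.

Definition other_end (e : edge G) v : V :=
  if (orient tau e).1 == v then (orient tau e).2 else (orient tau e).1.

Definition adjacent : rel V := [rel v u | [exists e, ends e == [set v; u]%SET]].

Lemma orient_neq e : (orient tau e).1 != (orient tau e).2.
Proof. by have := card_ends e; rewrite (orientP tau e) cards2; case: eqP. Qed.

Lemma other_end_neq e v : other_end e v != v.
Proof.
rewrite /other_end; case: (eqVneq (orient tau e).1 v) => // <-.
by rewrite eq_sym orient_neq.
Qed.

Lemma other_end_in e v : other_end e v \in ends e.
Proof. by rewrite (orientP tau e) /other_end; case: ifP; rewrite !inE eqxx ?orbT. Qed.

Lemma label_eqP e v u c c' : label_eq tau e v u c c' ->
  [/\ ends e = [set v; u]%SET, other_end e v = u, colour_at e v = c &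
    colour_at e u = c'].
Proof.
have := orient_neq e; rewrite /label_eq /other_end /colour_at (orientP tau e).
move=> neq [] [eo el]; move: neq; rewrite eo el /= => neq.
  by rewrite !eqxx (negbTE neq).
by rewrite !eqxx (negbTE neq) finset.setUC.
Qed.

Lemma label_eq_sym e v u c c' :
  label_eq tau e v u c c' -> label_eq tau e u v c' c.
Proof. by case; [right|left]. Qed.

Lemma adjacent_sym : symmetric adjacent.
Proof. by move=> v u; apply: eq_existsb => e; rewrite finset.setUC. Qed.

Lemma adjacent_irr : irreflexive adjacent.
Proof.
move=> v; apply/existsP => -[e /eqP ee].
by have := card_ends e; rewrite ee finset.setUid cards1.
Qed.

Lemma adjacent_neq v u : adjacent v u -> v != u.
Proof. by apply: contraTneq => ->; rewrite adjacent_irr. Qed.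

(** The three connecting edges have different end sets, so they are distinct and form a cycle. *)
Lemma no_adjacent3 : ~ has_cycle G 3 ->
  forall a b c, adjacent a b -> adjacent b c -> adjacent c a -> False.
Proof.
move=> no3 a b c ab bc ca.
have := (adjacent_neq ab, adjacent_neq bc, adjacent_neq ca) => -[[nab nbc] nca].
case/existsP: ab => e0 /eqP E0; case/existsP: bc => e1 /eqP E1.
case/existsP: ca => e2 /eqP E2; apply: no3.
exists (fun i => nth a [:: a; b; c] i), (fun i => nth e0 [:: e0; e1; e2] i).
have neqs := (negbTE nab, negbTE nbc, negbTE nca, eq_sym b a, eq_sym c b, eq_sym a c).
split.
- move=> [[|[|[|i]]] hi] [[|[|[|j]]] hj] //= eqx; apply/val_inj => //=;
  by move: nab nbc nca; rewrite ?eqx ?eqxx.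
- move=> [[|[|[|i]]] hi] [[|[|[|j]]] hj] //= eqe; apply/val_inj => //=;
  move: eqe => /(congr1 (@ends G)); rewrite ?E0 ?E1 ?E2 => /setP h;
  by have := h a; have := h b; have := h c; rewrite !inE !eqxx !neqs.
- by move=> [[|[|[|i]]] hi] //=; rewrite ?E0 ?E1 ?E2.
Qed.

Lemma no_adjacent4 : ~ has_cycle G 4 ->
  forall a b c d, adjacent a b -> adjacent b c -> adjacent c d -> adjacent d a ->
  a != c -> b != d -> False.
Proof.
move=> no4 a b c d ab bc cd da nac nbd.
have := (adjacent_neq ab, adjacent_neq bc, adjacent_neq cd, adjacent_neq da).
move=> [[[nab nbc] ncd] nda].
case/existsP: ab => e0 /eqP E0; case/existsP: bc => e1 /eqP E1.
case/existsP: cd => e2 /eqP E2; case/existsP: da => e3 /eqP E3; apply: no4.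
exists (fun i => nth a [:: a; b; c; d] i), (fun i => nth e0 [:: e0; e1; e2; e3] i).
have neqs := (negbTE nab, negbTE nbc, negbTE ncd, negbTE nda, negbTE nac, negbTE nbd,
  eq_sym b a, eq_sym c b, eq_sym d c, eq_sym a d, eq_sym c a, eq_sym d b).
split.
- move=> [[|[|[|[|i]]]] hi] [[|[|[|[|j]]]] hj] //= eqx; apply/val_inj => //=;
  by move: nab nbc ncd nda nac nbd; rewrite ?eqx ?eqxx.
- move=> [[|[|[|[|i]]]] hi] [[|[|[|[|j]]]] hj] //= eqe; apply/val_inj => //=;
  move: eqe => /(congr1 (@ends G)); rewrite ?E0 ?E1 ?E2 ?E3 => /setP h;
  by have := h a; have := h b; have := h c; have := h d; rewrite !inE !eqxx !neqs.
- by move=> [[|[|[|[|i]]]] hi] //=; rewrite ?E0 ?E1 ?E2 ?E3.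
Qed.

(** The map from incident edges to their other ends covers the neighbours; the extra 1 counts
    [v]. *)
Lemma card_nbhd v : (#|nbhd adjacent v| <= (max_degree G).+1)%N.
Proof.
rewrite -add1n -(cards1 v); apply: leq_trans (_ : #|v |: [set u | adjacent v u]%SET| <= _)%N.
  by apply/subset_leq_card/fintype.subsetP => u; rewrite !inE.
apply: leq_trans (leq_card_setU _ _) _; rewrite leq_add2l.
apply: leq_trans (leq_bigmax v); rewrite /degree -[X in (_ <= X)%N]cardsE.
apply: leq_trans (leq_imset_card (other_end^~ v) _).
apply/subset_leq_card/fintype.subsetP => u; rewrite inE => vu.
have [e Ee] := existsP vu; apply/imsetP; exists e.
  by rewrite !inE (eqP Ee) !inE eqxx.
have := other_end_in e v; rewrite (eqP Ee) !inE (negbTE (other_end_neq e v)).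
by move/eqP.
Qed.

Definition colour_degree v c : nat :=
  #|[pred e : edge G | `[< exists u c', label_eq tau e v u c c' >]]|.

(** An edge at [v] carries a single colour at [v], so it is counted for at most one [c]. *)
Lemma sum_colour_degree v (s : seq nat) : uniq s ->
  (\sum_(c <- s) colour_degree v c <= degree v)%N.
Proof.
move=> us; rewrite /colour_degree.
under eq_bigr do rewrite -sum1_card big_mkcond.
rewrite exchange_big /degree -sum1_card [leqRHS]big_mkcond /=.
apply: leq_sum => e _; rewrite -big_mkcond sum1_count inE.
have at_v c : e \in [pred e | `[< exists u c', label_eq tau e v u c c' >]] ->
    (v \in ends e) && (c == colour_at e v).
  rewrite inE => -[u [c' h]]; have [-> _ <- _] := label_eqP h.
  by rewrite !inE !eqxx.
apply: leq_trans (_ : count (pred1 (colour_at e v)) s * (v \in ends e) <= _)%N.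
  case: (boolP (v \in ends e)) => ve; last first.
    rewrite muln0 leqn0 -leqn0 leqNgt -has_count; apply/hasPn => c _.
    by apply: contraNN ve => /at_v/andP[].
  by rewrite muln1; apply: sub_count => c /at_v/andP[].
by rewrite count_uniq_mem //; case: (_ \in s); case: (v \in _).
Qed.

(** * Conflicts between palettes of equal size *)

Section Palette.
Variables (R : realType) (l : nat) (f : V -> 'I_l -> nat).
Hypothesis f_inj : forall v, injective (f v).

(** Colours become indices in ['I_l], so that all vertices share one finite colour type. *)
Definition palette_conflict v c u x : bool :=
  `[< exists e, label_eq tau e v u (f v c) (f u x) >].

Local Notation K := palette_conflict.

Lemma palette_conflict_sym v c u x : K v c u x = K u x v c.
Proof. by apply/asboolP/asboolP => -[e /label_eq_sym]; exists e. Qed.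

Lemma palette_conflict_adj v c u x : K v c u x -> adjacent v u.
Proof. by move=> /asboolP[e /label_eqP[Ee _ _ _]]; apply/existsP; exists e; apply/eqP. Qed.

(** Recovers a conflicting pair from its edge, as [f] is injective; conflicts are thus bounded by
    counting edges. *)
Let palette_pick (e : edge G) v : option (V * 'I_l) :=
  omap (pair (other_end e v))
    [pick x | f (other_end e v) x == colour_at e (other_end e v)].

Lemma palette_conflict_pick v c u x : K v c u x -> exists e,
  label_eq tau e v u (f v c) (f u x) /\ palette_pick e v = Some (u, x).
Proof.
move=> /asboolP[e le]; exists e; split=> //.
have [_ oe _ ce] := label_eqP le; rewrite /palette_pick oe ce.
case: pickP => [y /eqP/f_inj -> //|/(_ x)]; by rewrite eqxx.
Qed.

Lemma sum_palette_conflict v c u :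
  \sum_x (K v c u x)%:R <= (conflict_degree tau)%:R :> R.
Proof.
rewrite -natr_sum ler_nat -big_mkcond sum1_card.
apply: leq_trans (conflict_degree_ub tau (f v c) v u).
rewrite -(card_imset (pred_of_simpl [pred x | K v c u x]) (f := fun x => Some (u, x))); last first.
  by move=> x y [].
rewrite /conflict_count -[X in (_ <= X)%N]cardsE.
apply: leq_trans (leq_imset_card (palette_pick^~ v) _).
apply/subset_leq_card/fintype.subsetP => _ /imsetP[x Kx ->].
have [e [le <-]] := palette_conflict_pick Kx; apply: imset_f; rewrite !inE.
by exists (f u x).
Qed.

Lemma palette_load v c :
  (\sum_u \sum_x K v c u x <= colour_degree v (f v c))%N.
Proof.
rewrite pair_bigA -big_mkcond sum1_card /=.
rewrite -(card_imset (pred_of_simpl [pred i : V * 'I_l | K v c i.1 i.2]) (f := Some)); last first.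
  by move=> x y [].
rewrite /colour_degree -[X in (_ <= X)%N]cardsE.
apply: leq_trans (leq_imset_card (palette_pick^~ v) _).
apply/subset_leq_card/fintype.subsetP => _ /imsetP[[u x] Kx ->].
have [e [le <-]] := palette_conflict_pick Kx; apply: imset_f; rewrite !inE.
by exists u, (f u x).
Qed.

End Palette.
End MultigraphReduction.

(** * Choosing palettes from the lists *)

Section Palettes.
Variable R : realType.

(** Lists may be infinite; a finite part with at least [x] elements is then extracted. *)
Lemma counting_ge_seq (L : set nat) (x : R) : (x%:E <= counting L)%E ->
  exists s : seq nat, [/\ uniq s, {in s, forall c, L c} & x <= (size s)%:R].
Proof.
rewrite /counting; case: asboolP => [finL|infL] xL.
  exists (finmap.enum_fset (fset_set L)); split=> //.
    exact: finmap.fset_uniq.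
  by move=> c; rewrite -[_ \in _]/(c \in fset_set L) in_fset_set // => /set_mem.
have [B BL Bn] := infinite_set_fset (Num.truncn x).+1 infL.
exists (finmap.enum_fset B); split; first exact: finmap.fset_uniq.
  by move=> c cB; apply: BL.
apply: le_trans (_ : (Num.truncn x).+1%:R <= _); first exact: ltW (truncnS_gt _).
by rewrite ler_nat.
Qed.

(* Markov's inequality: the colour degrees at [v] add up to at most [degree v],
   so at most half of [x] colours can exceed [2 max_degree / x]. *)
Lemma half_palette (G : multigraph) (tau : edge_labelling G) (v : vertex G)
    (L : set nat) (x : R) (l : nat) : (0 < max_degree G)%N ->
  0 < x -> (x%:E <= counting L)%E ->
  (forall n : nat, x / 2 <= n%:R -> (l <= n)%N) ->
  exists f : 'I_l -> nat, injective f /\ forall i, L (f i) /\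
    (colour_degree tau v (f i))%:R * x <= 2 * (max_degree G)%:R.
Proof.
move=> D0 x0 xL lmin; have [s [us sL xs]] := counting_ge_seq xL.
pose a c := (colour_degree tau v c)%:R * x <= 2 * (max_degree G)%:R.
pose good := [seq c <- s | a c]; pose bad := [seq c <- s | ~~ a c].
have gb : (size good + size bad = size s)%N.
  by rewrite !size_filter count_predC.
have D0' : 0 < (max_degree G)%:R :> R by rewrite ltr0n.
have badx : (size bad)%:R * 2 <= x.
  have : (\sum_(c <- bad) colour_degree tau v c)%:R <= (max_degree G)%:R :> R.
    rewrite ler_nat; apply: leq_trans (sum_colour_degree tau v _) _.
      exact: filter_uniq.
    exact: leq_bigmax.
  move=> /(ler_wpM2r (ltW x0)); rewrite natr_sum mulr_suml => le.
  rewrite -(ler_pM2l D0'); apply: le_trans le.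
  have -> : (max_degree G)%:R * ((size bad)%:R * 2) =
      \sum_(c <- bad) 2 * (max_degree G)%:R :> R.
    by rewrite big_const_seq count_predT iter_addr_0 -[RHS]mulr_natl; ring.
  rewrite big_seq [leRHS]big_seq; apply: ler_sum => c.
  by rewrite mem_filter /a -ltNge => /andP[/ltW].
have lgood : (l <= size good)%N.
  apply: lmin; move: xs; rewrite -gb natrD; lra.
exists (fun i : 'I_l => nth 0%N good i); split.
  move=> i j /eqP; rewrite nth_uniq ?filter_uniq ?(leq_trans _ lgood) //.
  by move=> /eqP/val_inj.
move=> i; have : nth 0%N good i \in good by rewrite mem_nth // (leq_trans _ lgood).
by rewrite mem_filter => /andP[ai /sL].
Qed.

End Palettes.

(** * From lists to the nibble and back *)

Theorem theorem1p5 (R : realType) (eps : R) (heps : 0 < eps) :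
  exists Delta0 : nat,
    forall (G : multigraph) (L : vertex G -> set nat) (tau : edge_labelling G),
      let Delta : R := (max_degree G)%:R in
      (Delta0 < max_degree G)%N ->
      ~ has_cycle G 3 -> ~ has_cycle G 4 ->
      (forall v : vertex G,
         (((2 * Num.sqrt 2 + eps) * Num.sqrt (Delta / ln Delta))%:E
            <= counting (L v))%E) ->
      (conflict_degree tau)%:R
        <= powR Delta (1 / 4 * eps ^+ 2 / (eps + 5) ^+ 2) ->
      exists sigma : vertex G -> nat, proper_conflict_colouring tau L sigma.
Proof.
have [Delta0 params] := nibble_parameters heps.
exists Delta0 => G L tau Delta Delta_big no3 no4 sizeL smallD.
have Delta_gt0 : (0 < max_degree G)%N by apply: leq_trans Delta_big.
have [] := params _ Delta_big; rewrite -/Delta; set x := _ * Num.sqrt _ in sizeL *.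
move=> x0 /(_ _ (conflict_degree tau)%:R) par.
have ex_l : exists l : nat, x / 2 <= l%:R.
  by exists (Num.truncn (x / 2)).+1; exact: ltW (truncnS_gt _).
(* Minimality of [l] gives both [l <= x / 2 + 1] and enough good colours in each list. *)
case: (ex_minnP ex_l) => l lx lmin.
have l0 : (0 < l)%N.
  by rewrite -(ltr_nat R); apply: lt_le_trans lx; rewrite divr_gt0.
have lx1 : l%:R <= x / 2 + 1.
  rewrite -lerBlDr leNgt; apply/negP => /ltW le.
  have : x / 2 <= l.-1%:R by rewrite -subn1 natrB.
  by move=> /lmin; rewrite leqNgt prednK // leqnn.
have [al [de [B [eta [Q [[al0 al1 de0 de1 B0] [[e0 e1 eal small] [DQ DQB PQ alT]]]]]]]] :=
  par l lx lx1 (ler0n _ _) smallD.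
have palettes v := half_palette tau v Delta_gt0 x0 (sizeL v) lmin.
have [f fP] := choice palettes.
have f_inj v : injective (f v) by have [] := fP v.
set T := 4%:R * Delta / x ^+ 2 in PQ alT.
have T0 : 0 <= T by rewrite divr_ge0 ?sqr_ge0 // mulr_ge0 ?ler0n.
have [sigma [_ sigma_ok]] : solvable (palette_conflict tau f) predT
    (fun (_ : vertex G) (_ : 'I_l) => l%:R^-1 : R).
  apply: (nibble_iter (@adjacent_sym G) (@adjacent_irr G) (palette_conflict_sym tau f)
    (@palette_conflict_adj _ tau l f) (no_adjacent3 no3) (no_adjacent4 no4)
    (@sum_palette_conflict _ tau R l f f_inj) (card_nbhd tau)
    (n := (Num.truncn (T * 32%:R / al)).+1) (Ordinal l0) al0 al1 de0 de1 B0 e0 e1 eal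
    _ (ler0n _ _) DQ DQB _ T0 PQ alT).
  - by rewrite card_ord.
  - by rewrite invr_ge0.
  (* The number of steps is chosen so that [n * (al / 32)] alone exceeds [T]. *)
  - have : T * 32%:R / al < (Num.truncn (T * 32%:R / al)).+1%:R := truncnS_gt _.
    by rewrite ltr_pdivrMr //; lra.
  split=> //.
  - by move=> v; rewrite sumr_const card_ord -[LHS]mulr_natl mulfV // gt_eqF ?ltr0n.
  move=> v c; rewrite /colour_load.
  under eq_bigr do rewrite -mulr_suml; rewrite -mulr_suml.
  have load : \sum_u \sum_y (palette_conflict tau f v c u y)%:R <=
      (colour_degree tau v (f v c))%:R :> R.
    under eq_bigr do rewrite -natr_sum; rewrite -natr_sum ler_nat.
    exact: palette_load.
  rewrite ler_pdivrMr ?ltr0n //; apply: le_trans load _.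
  have [_ /(_ c)[_ cdx]] := fP v.
  have : (colour_degree tau v (f v c))%:R <= 2 * Delta / x by rewrite ler_pdivlMr.
  move=> /le_trans; apply.
  (* As x / 2 <= l, at most 2 Delta / x conflicts of weight 1 / l each make a load of at most
     [T]. *)
  have -> : 2 * Delta / x = T * (x / 2) by rewrite /T; field; rewrite gt_eqF.
  by rewrite ler_wpM2l.
exists (fun v => f v (sigma v)); split=> [v|[e [u [v le]]]].
  by have [_ /(_ (sigma v))[]] := fP v.
have /negP[] := sigma_ok v u isT isT; apply/asboolP.
by exists e.
Qed.
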